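(* Let $\Omega=\Omega_1\times\cdots\times\Omega_N$ with each $\Omega_k$ finite or countably infinite, and let $\mu_0(x)=\prod_{i=1}^N\mu_{0,i}(x_i)$ with $\mu_{0,i}$ a probability measure on $\Omega_i$ for each $i$. Let $\beta>0$, let $J_{i,j}\in\mathbb R$ ($i,j\in[N]$) satisfy $J_{i,i}=0$ and $J_{i,j}=J_{j,i}$, and let $w_{i,j}:\Omega_i\times\Omega_j\to\mathbb R$ be functions with $\|w_{i,j}\|_\infty=\sup_{x_i,x_j}|w_{i,j}(x_i,x_j)|<\infty$. Let $\mu$ be the probability measure on $\Omega$ $$\mu(x)=\frac{\mu_0(x)\,e^{\beta W(x)}}{Z},\qquad W(x)=\frac12\sum_{i,j\in[N]}J_{i,j}\,w_{i,j}(x_i,x_j),$$ where $Z$ is the normalizing factor. Set $\varepsilon_{i,k}=4\beta|J_{k,i}|\,\|w_{i,k}\|_\infty$ and assume $$q:=\max_i\sum_{k:\,k\ne i}e^{\varepsilon_{i,k}}\big(e^{2\varepsilon_{i,k}}-1\big)<\frac23.$$ Then for every bounded measurable function $f:\Omega\to[0,\infty)$ $$\mathrm{Ent}_\mu(f)\le C\sum_{k=1}^N\mu\big[\mathrm{Ent}_{\mu_k}(f)\big],\qquad C=\Big(1-\frac32q\Big)^{-1}.$$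
   Context: Notation: $[N]=\{1,\dots,N\}$; $\mu[f]$ is the expectation of $f$ under $\mu$. For bounded $f\ge0$, $\mathrm{Ent}_\mu(f)=\mu[f\log f]-\mu[f]\log\mu[f]$. For each $k$, $\mu_k[f](x)=\mu[f\mid x_j,\ j\ne k]$ is the conditional expectation given all coordinates except the $k$-th, and $\mathrm{Ent}_{\mu_k}(f)$ is the function $\mu_k[f\log f]-\mu_k[f]\log\mu_k[f]$.
   Formalization: The formal theorem additionally assumes that the sup norms of w_{i,j} and w_{j,i} agree for all i, j; without some such symmetry the claim fails, e.g. on a large star graph with w_{1,k}=0 and w_{k,1}(a,b)=ab. *)

(* Defs.v *)
From HB Require Import structures.
From mathcomp Require Import all_boot all_order all_algebra.
From mathcomp Require Import all_classical all_reals all_analysis.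

Set Implicit Arguments.
Unset Strict Implicit.
Unset Printing Implicit Defensive.

Import Order.TTheory GRing.Theory Num.Theory.
Import numFieldNormedType.Exports.

Local Open Scope classical_set_scope.
Local Open Scope ring_scope.

(* Library measurable types are pointed; this costs no generality, as every
   space below carries a probability measure and is therefore nonempty. *)
Notation discrete T := (g_sigma_algebraType (@discrete_measurable T%type)).

Section entropy.
Context {d : measure_display} {T : measurableType d} {R : realType}.
Implicit Types (P : probability T R) (f : T -> R).

Definition mean P f : R := \int[P]_x f x.

(* [ln 0 = 0] in the library, so [0 log 0 = 0]. *)
Definition Ent P f : R :=
  mean P (fun x => f x * ln (f x)) - mean P f * ln (mean P f).

End entropy.

Section coordinates.
Context {N : nat} {Omega : 'I_N -> pointedType} {R : realType}.
Local Notation state := (forall i, Omega i).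
Implicit Types (P : probability (discrete state) R) (f : state -> R).

Definition fiber (k : 'I_N) (x : state) : set state :=
  [set y | forall j, j != k -> y j = x j].

(* P[f | x_j, j != k]: on a countable space, the average of f over the atom of
   x in the sigma-algebra generated by the coordinates j != k. If the atom is
   P-null the value is 0, since division by 0 yields 0. *)
Definition cmean P (k : 'I_N) f (x : state) : R :=
  (\int[P]_(y in (fiber k x : set (discrete state))) f y) /
    fine (P (fiber k x)).

Definition cEnt P (k : 'I_N) f (x : state) : R :=
  cmean P k (fun y => f y * ln (f y)) x - cmean P k f x * ln (cmean P k f x).

End coordinates.

Section pair_interaction.
Context {N : nat} {Omega : 'I_N -> pointedType} {R : realType}.
Local Notation state := (forall i, Omega i).

Definition abs_values (T U : Type) (g : T -> U -> R) : set R :=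
  [set r | exists a b, r = `|g a b|].

Definition supnorm (T U : Type) (g : T -> U -> R) : R := sup (abs_values g).

Definition product_mass (mu0 : forall i, probability (discrete (Omega i)) R)
    (x : state) : R :=
  \prod_(i < N) fine (mu0 i [set x i]).

Definition interaction (J : 'I_N -> 'I_N -> R)
    (w : forall i j, Omega i -> Omega j -> R) (x : state) : R :=
  2^-1 * \sum_(i < N) \sum_(j < N) J i j * w i j (x i) (x j).

Definition gibbs_weight (mu0 : forall i, probability (discrete (Omega i)) R)
    (beta : R) (J : 'I_N -> 'I_N -> R)
    (w : forall i j, Omega i -> Omega j -> R) (x : state) : R :=
  product_mass mu0 x * expR (beta * interaction J w x).

Definition partition_function
    (mu0 : forall i, probability (discrete (Omega i)) R)
    (beta : R) (J : 'I_N -> 'I_N -> R)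
    (w : forall i j, Omega i -> Omega j -> R) : R :=
  fine (\esum_(x in [set: state]) (gibbs_weight mu0 beta J w x)%:E).

(* [P] has mass function mu0(x) exp(beta W(x)) / Z; as the state space is
   countable, this determines [P]. *)
Definition is_gibbs (mu0 : forall i, probability (discrete (Omega i)) R)
    (beta : R) (J : 'I_N -> 'I_N -> R)
    (w : forall i j, Omega i -> Omega j -> R)
    (P : probability (discrete state) R) : Prop :=
  forall x : state,
    P [set x] =
      (gibbs_weight mu0 beta J w x / partition_function mu0 beta J w)%:E.

Definition epsilon (beta : R) (J : 'I_N -> 'I_N -> R)
    (w : forall i j, Omega i -> Omega j -> R) (i k : 'I_N) : R :=
  4 * beta * `|J k i| * supnorm (w i k).

(* The summands are nonnegative, so the default value 0 of the maximum only
   matters for N = 0. *)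
Definition influence (beta : R) (J : 'I_N -> 'I_N -> R)
    (w : forall i j, Omega i -> Omega j -> R) : R :=
  \big[Num.max/0]_(i < N) \sum_(k < N | k != i)
    expR (epsilon beta J w i k) * (expR (2 * epsilon beta J w i k) - 1).

End pair_interaction.

(* Main.v *)
(** Let mu_k f be the conditional expectation given all coordinates but the
    k-th, D(f) = sum_k mu[Ent_{mu_k} f], and C > (1 - 3q/2)^-1.  Moving f in
    the heat-bath direction h = sum_i (mu_i f - f) changes Ent(f) at rate
    - sum_i E_i with E_i = mu[(f - mu_i f) log f] >= 0, and D(f) at rate at
    most - (1 - 3q/2) sum_i E_i.  The latter is a two-site estimate: for i <> k
      mu[(f - mu_i f) (log (mu_k f) - log f)]
        <= 3/4 e^eps (e^(2 eps) - 1) (E_i + E_k)   with eps = epsilon_{i,k};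
    the left-hand side is nonpositive under a product measure, and in general
    the error is controlled by the oscillation, at most a factor e^eps, of the
    density between the laws of x_k given different values of x_i.
    Hence C D - Ent decreases strictly along h unless all E_i vanish, that is
    unless f is constant.  On a finite space its minimum over the compact set
    {lo <= f <= hi}, lo > 0, which h does not leave, is therefore attained at
    an f constant on the support and is nonnegative; C may then tend to
    (1 - 3q/2)^-1.  The countable case follows by restricting mu to finite
    boxes (again a Gibbs measure with the same interaction) and replacing f by
    f + a with a > 0: by the variational formula
      Ent_nu(f) = inf_t nu[f log (f / t) - f + t]
    neither operation increases the right-hand side, while the left-hand side
    converges. *)
Require Import Defs.
From HB Require Import structures.
From mathcomp Require Import all_boot all_order all_algebra.
From mathcomp Require Import all_classical all_reals all_analysis.
From mathcomp Require Import ring lra.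

Set Implicit Arguments.
Unset Strict Implicit.
Unset Printing Implicit Defensive.

Import Order.TTheory GRing.Theory Num.Theory.
Import numFieldNormedType.Exports.

Local Open Scope classical_set_scope.
Local Open Scope ring_scope.

(** * Logarithmic inequalities *)

Section real_inequalities.
Context {R : realType}.
Implicit Types u v t x y : R.

Lemma ln_le_subr1 t : 0 < t -> ln t <= t - 1.
Proof.
by move=> t0; have := @le_ln1Dx R (t - 1); rewrite [1 + _]addrC subrK => -> //; lra.
Qed.

Lemma lnB_le u v : 0 < u -> 0 < v -> ln u - ln v <= u / v - 1.
Proof.
by move=> u0 v0; rewrite -ln_div ?posrE//; apply/ln_le_subr1/divr_gt0.
Qed.

(** The difference of the two sides vanishes at 1 and has derivative [ln x + x^-1 - 1], nonnegative
    by [ln t <= t - 1] at [t = x^-1]. *)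
Lemma logmean_ge1 y : 1 <= y -> 2 * (y - 1) <= (y + 1) * ln y.
Proof.
move=> y1.
pose g : R -> R := fun x => (x + 1) * ln x - 2 * (x - 1).
have dg x : 0 < x -> is_derive x (1 : R) g (ln x + x^-1 - 1).
  move=> x0; have dl := is_derive1_ln x0.
  rewrite /g; apply: is_derive_eq.
  rewrite /GRing.scale /=; by field; rewrite gt_eqF.
suff: g 1 <= g y by rewrite /g ln1; lra.
have [->//|yn1] := eqVneq y 1.
apply: (@ger0_derive1_ndecr _ g 1 y) => //.
- move=> x; rewrite in_itv/= => /andP[x1 _].
  by have /dg[] : 0 < x by lra.
- move=> x; rewrite in_itv/= => /andP[x1 _].
  have x0 : 0 < x by lra.
  rewrite derive1E; have [_ ->] := dg _ x0.
  have := @ln_le_subr1 x^-1; rewrite invr_gt0 lnV ?posrE// => /(_ x0); lra.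
- apply: derivable_within_continuous => x; rewrite in_itv/= => /andP[x1 _].
  by have /dg[] : 0 < x by lra.
Qed.

(* The logarithmic mean is at most the arithmetic mean. *)
Lemma logmean_le_mean u v : 0 < u -> 0 < v ->
  2 * (u - v) ^+ 2 <= (u - v) * (ln u - ln v) * (u + v).
Proof.
wlog uv : u v / v <= u => [H u0 v0|u0 v0].
  have [/H|/ltW/H] := leP v u; first exact.
  by move=> /(_ v0 u0); rewrite -[ln v - _]opprB; nra.
have t1 : 1 <= u / v by rewrite ler_pdivlMr// mul1r.
have := logmean_ge1 t1; rewrite ln_div ?posrE//.
have -> : u = u / v * v by rewrite divfK ?gt_eqF.
move: t1; rewrite mulfK ?gt_eqF//; set t := u / v => t1.
set l := _ - ln v => H.
have : 0 <= (t - 1) * v ^+ 2 by rewrite mulr_ge0 ?sqr_ge0 ?subr_ge0.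
by move=> /ler_wpM2l/(_ _ _ H); nra.
Qed.

(* Tangent-plane inequality at (x, y) for the convex 1-homogeneous function
   (u - v) (ln u - ln v). *)
Lemma sub_lnB_tangent u v x y : 0 < u -> 0 < v -> 0 < x -> 0 < y ->
  (ln x - ln y + 1 - y / x) * u + (ln y - ln x + 1 - x / y) * v <=
  (u - v) * (ln u - ln v).
Proof.
move=> u0 v0 x0 y0.
have h1 := @lnB_le (v * x) (u * y) (mulr_gt0 v0 x0) (mulr_gt0 u0 y0).
have h2 := @lnB_le (u * y) (v * x) (mulr_gt0 u0 y0) (mulr_gt0 v0 x0).
rewrite !lnM ?posrE// in h1 h2.
have e1 : v * x / (u * y) * u = x / y * v by field; rewrite !gt_eqF.
have e2 : u * y / (v * x) * v = y / x * u by field; rewrite !gt_eqF.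
have := ler_wpM2r (ltW u0) h1; have := ler_wpM2r (ltW v0) h2.
by rewrite !mulrBl e1 e2 !mul1r; lra.
Qed.

(* u and v stand for the means of f(a,.) and f(b,.) under one common law, F for
   the mean of f(a,.) under its own conditional law. The cases 6 u < v and
   v <= 6 u are treated separately: in the first ln u - ln v is bounded away
   from 0, in the second Young's inequality applies, with the weight s of H. *)
Lemma cross_term_le E K F u v : 1 <= E -> 0 <= K -> 0 < F -> 0 < u -> 0 < v ->
  u <= E * F -> F <= E * u ->
  (forall s, 0 < s -> `|u - F| <= (E - 1) * (s * K / 2 + F / (2 * s))) ->
  (u - v) * (ln F - ln u) <=
  3 / 8 * (E * (E ^+ 2 - 1)) * ((u - v) * (ln u - ln v)) +
  3 / 4 * (E * (E ^+ 2 - 1)) * K.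
Proof.
move=> E1 K0 F0 u0 v0 uEF FEu H.
set c := 3 / 8 * (E * (E ^+ 2 - 1)).
have -> : 3 / 4 * (E * (E ^+ 2 - 1)) = 2 * c by rewrite /c; field.
have cE : 3 / 4 * E * (E - 1) <= c.
  have : 0 <= E * (E - 1) ^+ 2 by rewrite mulr_ge0 ?sqr_ge0//; lra.
  by rewrite /c; lra.
have phi0 : 0 <= (u - v) * (ln u - ln v).
  have := logmean_le_mean u0 v0; have : 0 <= (u - v) ^+ 2 by exact: sqr_ge0.
  by move=> h1 h2; rewrite -(@pmulr_lge0 _ (u + v)); lra.
have lnb : `|ln F - ln u| <= E - 1.
  rewrite ler_norml; apply/andP; split.
    rewrite lerNl opprB; apply: le_trans (lnB_le u0 F0) _.
    by rewrite lerD2r ler_pdivrMr.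
  by apply: le_trans (lnB_le F0 u0) _; rewrite lerD2r ler_pdivrMr.
apply: le_trans (ler_norm _) _; rewrite normrM.
have c0 : 0 <= c by apply: le_trans cE; rewrite !mulr_ge0//; lra.
clearbody c.
have [v6|v6] := ltP (6 * u) v.
  apply: (@le_trans _ _ (`|u - v| * (E - 1))); first by rewrite ler_wpM2l.
  rewrite (@ltr0_norm _ (u - v)); last lra.
  apply: (@le_trans _ _ (c * ((u - v) * (ln u - ln v)))); last first.
    by rewrite lerDl; nra.
  set l := ln u - ln v.
  have hl : (v - u) <= - l * (u + v) / 2.
    have := logmean_le_mean u0 v0; rewrite -/l => h.
    by rewrite -(ler_pM2l (_ : 0 < v - u)); [nra|lra].
  (* For [6 u < v] the quotient [2 (v - u) / (u + v)] exceeds 10/7, so [3/4 E (- l) >= 15/14 > 1]: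
     this is the room that absorbs [E - 1] into [c (- l)]. *)
  have hl2 : 10 / 7 <= - l by rewrite -(ler_pM2r (_ : 0 < u + v)); [nra|lra].
  rewrite opprB -(mulrNN (u - v)) opprB mulrCA.
  rewrite ler_wpM2l//; first by rewrite subr_ge0; lra.
  apply: le_trans (_ : 3 / 4 * E * (E - 1) * - l <= _); last by rewrite ler_wpM2r//; lra.
  have : 1 * (10 / 7) <= E * - l by rewrite ler_pM//; lra.
  move=> El; have : 0 <= (E - 1) * (3 / 4 * (E * - l) - 1) by apply: mulr_ge0; lra.
  lra.
have [->|uv] := eqVneq u v; first by rewrite subrr normr0 !mul0r mulr0 add0r !mulr_ge0.
have [E1'|En1] := eqVneq E 1.
  have -> : F = u by rewrite E1' in uEF FEu; lra.
  rewrite subrr normr0 mulr0; apply: addr_ge0; last by rewrite !mulr_ge0.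
  exact: mulr_ge0.
have d0 : 0 < E - 1 by rewrite subr_gt0 lt_neqAle eq_sym En1.
have c0' : 0 < c by apply: lt_le_trans cE; rewrite !mulr_gt0//; lra.
(* [F] and [u] differ at most by a factor [E], so the smaller one serves as denominator in
   [|ln F - ln u| <= |u - F| / M], at the cost of one factor [E]. *)
pose M := Num.min F u.
have M0 : 0 < M by rewrite lt_min F0 u0.
have lnF : `|ln F - ln u| <= `|u - F| / M.
  have MF : M <= F by rewrite ge_min lexx.
  have Mu : M <= u by rewrite ge_min lexx orbT.
  have step a b : 0 < a -> 0 < b -> M <= b -> ln a - ln b <= `|a - b| / M.
    move=> a0 b0 Mb; apply: le_trans (lnB_le a0 b0) _.
    have -> : a / b - 1 = (a - b) / b by field; rewrite gt_eqF.
    apply: (@le_trans _ _ (`|a - b| / b)).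
      by rewrite ler_wpM2r ?ler_norm// invr_ge0 ltW.
    by rewrite ler_wpM2l// lef_pV2 ?posrE.
  rewrite ler_norml; apply/andP; split.
    by rewrite lerNl opprB; apply: step.
  by rewrite distrC; apply: step.
have uv0 : 0 < `|u - v| by rewrite normr_gt0 subr_eq0.
(* This weight makes the [K] term of [H] contribute exactly [2 * c * K]; only the term in [F]
   remains to be absorbed. *)
pose s := 4 * c * M / (`|u - v| * (E - 1)).
have s0 : 0 < s by rewrite divr_gt0 ?mulr_gt0.
apply: (@le_trans _ _ (`|u - v| * ((E - 1) * (s * K / 2 + F / (2 * s)) / M))).
  rewrite ler_wpM2l//; apply: le_trans lnF _.
  by rewrite ler_wpM2r ?H// invr_ge0 ltW.
have -> : `|u - v| * ((E - 1) * (s * K / 2 + F / (2 * s)) / M) =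
  2 * c * K + F * (E - 1) ^+ 2 * `|u - v| ^+ 2 / (8 * c * M ^+ 2).
  by rewrite /s; field; rewrite !gt_eqF.
rewrite addrC lerD2r ler_pdivrMr; last by rewrite !mulr_gt0// exprn_gt0.
rewrite real_normK ?num_real//.
set p := (u - v) * (ln u - ln v).
have hp : 2 * (u - v) ^+ 2 <= p * (7 * u).
  apply: le_trans (logmean_le_mean u0 v0) _.
  by rewrite ler_wpM2l//; lra.
have FuM : F * u <= E * M ^+ 2.
  by rewrite /M; have [h|h] := leP F u; nra.
have h1 : F * (E - 1) ^+ 2 * (u - v) ^+ 2 <= 7 / 2 * E * (E - 1) ^+ 2 * M ^+ 2 * p.
  have a0 : 0 <= F * (E - 1) ^+ 2 by rewrite mulr_ge0 ?sqr_ge0// ltW.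
  have := ler_wpM2l a0 hp; have b0 : 0 <= p * (E - 1) ^+ 2 by rewrite mulr_ge0 ?sqr_ge0.
  have := ler_wpM2l b0 FuM; nra.
apply: le_trans h1 _.
have cc : 9 / 16 * E ^+ 2 * (E - 1) ^+ 2 <= c ^+ 2.
  have -> : 9 / 16 * E ^+ 2 * (E - 1) ^+ 2 = (3 / 4 * E * (E - 1)) ^+ 2 by field.
  rewrite ler_pXn2r ?nnegrE//; nra.
have pm0 : 0 <= p * M ^+ 2 by rewrite mulr_ge0 ?sqr_ge0.
have e0 : 0 <= (E - 1) ^+ 2 by exact: sqr_ge0.
(* By [cc], [8 c^2 >= 9/2 E^2 (E - 1)^2], and [E >= 1]. The 7 comes from [u + v <= 7 u], that is
   from the cut at [6 u]. *)
have : 7 / 2 * E * (E - 1) ^+ 2 <= 8 * c ^+ 2 by nra.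
move=> /(ler_wpM2r pm0); nra.
Qed.

Lemma xlnx_tangent_le u v : 0 < u -> 0 < v ->
  u * ln u + (v - u) * (ln u + 1) <= v * ln v.
Proof.
move=> u0 v0; have := ler_wpM2l (ltW v0) (lnB_le u0 v0).
have -> : v * (u / v - 1) = u - v by field; rewrite gt_eqF.
by lra.
Qed.

(** Multiply [ln (v / u) <= v / u - 1] by [v]. The quadratic remainder becomes the second-order loss
    of a small step along the drift. *)
Lemma xlnx_tangent_ge u v : 0 < u -> 0 < v ->
  v * ln v <= u * ln u + (v - u) * (ln u + 1) + (v - u) ^+ 2 / u.
Proof.
move=> u0 v0; have := ler_wpM2l (ltW v0) (lnB_le v0 u0).
have -> : v * (v / u - 1) = (v - u) + (v - u) ^+ 2 / u by field; rewrite gt_eqF.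
by lra.
Qed.

Lemma sub_lnB_ge0 u v : 0 < u -> 0 < v -> 0 <= (u - v) * (ln u - ln v).
Proof.
move=> u0 v0; have [h|h] := leP v u.
  by rewrite mulr_ge0// subr_ge0// ler_ln ?posrE.
by rewrite mulr_le0// subr_le0 ?ler_ln ?posrE// ltW.
Qed.

Lemma sub_lnB_eq0 u v : 0 < u -> 0 < v -> (u - v) * (ln u - ln v) = 0 -> u = v.
Proof.
move=> u0 v0 /eqP; rewrite mulf_eq0 !subr_eq0 => /orP[/eqP//|/eqP].
by apply: ln_inj; rewrite posrE.
Qed.

(** The arithmetic-geometric mean inequality gives [x + y >= 2]. This turns a lower bound [1 / E] on
    a density into the deviation [E - 1]. *)
Lemma onem_le_subr1 x y : 1 <= x -> 0 < y -> 1 <= x * y -> 1 - y <= x - 1.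
Proof. by have := sqr_ge0 (x - y); nra. Qed.

End real_inequalities.

(** * The two-site estimate *)

Lemma psum_gt0_ex (R : realType) (I : finType) (h : I -> R) :
  (forall i, 0 <= h i) -> 0 < \sum_i h i -> exists i, 0 < h i.
Proof.
move=> h0 /lt0r_neq0/eqP/psumr_neq0P-/(_ (fun i _ => h0 i))[i /= hi].
by exists i.
Qed.

(** * Weighted means on a finite set *)

Section weighted_mean.
Context {R : realType} {T : finType}.
Implicit Types (w u v r : T -> R) (a c s : R).

(** The weights need not be normalised; if their total is 0, so is the value. *)
Definition wmean w u : R := (\sum_t w t * u t) / \sum_t w t.

Lemma eq_wmean w u v : u =1 v -> wmean w u = wmean w v.
Proof. by move=> uv; congr (_ / _); apply: eq_bigr => t _; rewrite uv. Qed.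

Lemma wmeanD w u v : wmean w (fun t => u t + v t) = wmean w u + wmean w v.
Proof.
by rewrite /wmean -mulrDl -big_split; congr (_ / _); apply: eq_bigr => t _;
  rewrite mulrDr.
Qed.

Lemma wmeanZ w a u : wmean w (fun t => a * u t) = a * wmean w u.
Proof.
by rewrite /wmean mulrA mulr_sumr; congr (_ / _); apply: eq_bigr => t _;
  rewrite mulrCA.
Qed.

Lemma wmeanB w u v : wmean w (fun t => u t - v t) = wmean w u - wmean w v.
Proof.
rewrite -[- wmean w v]mulN1r -wmeanZ -wmeanD.
by apply: eq_wmean => t; rewrite mulN1r.
Qed.

Context (w : T -> R) (w_ge0 : forall t, 0 <= w t) (w_gt0 : 0 < \sum_t w t).

Lemma sum_wmean u : \sum_t w t * u t = (\sum_t w t) * wmean w u.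
Proof. by rewrite /wmean mulrCA divff ?mulr1// gt_eqF. Qed.

Lemma wmean_cst a : wmean w (fun=> a) = a.
Proof. by rewrite /wmean -mulr_suml mulrAC divff ?mul1r// gt_eqF. Qed.

Lemma le_wmean u v : (forall t, 0 < w t -> u t <= v t) -> wmean w u <= wmean w v.
Proof.
move=> uv; rewrite /wmean ler_pM2r ?invr_gt0//; apply: ler_sum => t _.
have [<-|wt] := eqVneq 0 (w t); first by rewrite !mul0r.
by rewrite ler_wpM2l// uv// lt_neqAle wt w_ge0.
Qed.

Lemma wmean_gt0 u : (forall t, 0 < u t) -> 0 < wmean w u.
Proof.
move=> u0; rewrite /wmean divr_gt0//.
have [t wt] := psum_gt0_ex w_ge0 w_gt0.
rewrite (bigD1 t)//= ltr_pwDl ?mulr_gt0// sumr_ge0// => t' _.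
by rewrite mulr_ge0// ltW.
Qed.

Lemma wmean_lb lo u : (forall t, lo <= u t) -> lo <= wmean w u.
Proof. by move=> h; rewrite -[leLHS]wmean_cst; apply: le_wmean. Qed.

Lemma wmean_ub hi u : (forall t, u t <= hi) -> wmean w u <= hi.
Proof. by move=> h; rewrite -[leRHS]wmean_cst; apply: le_wmean. Qed.

(** Covariance as a double sum over two independent copies: the mean is expanded over [t'], and
    exchanging the copies symmetrises the product. *)
Lemma sum_wcov u h :
  \sum_t w t * ((u t - wmean w u) * h t) =
  (2 * \sum_t w t)^-1 *
  \sum_t \sum_t' w t * w t' * ((u t - u t') * (h t - h t')).
Proof.
have e1 : \sum_t \sum_t' w t * w t' * ((u t - u t') * h t) =
    (\sum_t w t) * \sum_t w t * ((u t - wmean w u) * h t).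
  rewrite mulr_sumr; apply: eq_bigr => t _.
  transitivity (w t * h t * \sum_t' w t' * (u t - u t')).
    by rewrite mulr_sumr; apply: eq_bigr => t' _; ring.
  by rewrite sum_wmean wmeanB wmean_cst; ring.
have e2 : \sum_t \sum_t' w t * w t' * ((u t - u t') * (h t - h t')) =
    2 * \sum_t \sum_t' w t * w t' * ((u t - u t') * h t).
  rewrite mulrDl mul1r [X in _ + X]exchange_big -big_split; apply: eq_bigr => t _ /=.
  by rewrite -big_split; apply: eq_bigr => t' _ /=; ring.
by rewrite e2 e1 mulrA mulKf// mulf_neq0// gt_eqF.
Qed.

(** Jensen's inequality for the convex function [(u - v) (ln u - ln v)]: average its tangent plane
    at the two means, which takes the value of the function there. *)
Lemma sub_lnB_wmean u v : (forall t, 0 < u t) -> (forall t, 0 < v t) ->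
  (wmean w u - wmean w v) * (ln (wmean w u) - ln (wmean w v)) <=
  wmean w (fun t => (u t - v t) * (ln (u t) - ln (v t))).
Proof.
move=> u0 v0; set U := wmean w u; set V := wmean w v.
have U0 : 0 < U by exact: wmean_gt0.
have V0 : 0 < V by exact: wmean_gt0.
apply: (@le_trans _ _ (wmean w (fun t => (ln U - ln V + 1 - V / U) * u t +
   (ln V - ln U + 1 - U / V) * v t))); last first.
  by apply: le_wmean => t _; exact: sub_lnB_tangent.
rewrite wmeanD !wmeanZ -/U -/V le_eqVlt; apply/orP; left; apply/eqP.
by field; rewrite !gt_eqF.
Qed.

(** * Change of weights with a bounded density ratio *)

Section reweighting.
Context (E : R) (r : T -> R).
Hypotheses (E_ge1 : 1 <= E) (r_gt0 : forall t, 0 < r t)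
  (r_ratio : forall t t', r t <= E * r t').
Local Notation rho := (fun t => r t / wmean w r).

Let wr_gt0 : 0 < wmean w r. Proof. exact: wmean_gt0. Qed.

Let rho_le t : rho t <= E.
Proof.
rewrite ler_pdivrMr// -wmeanZ -[leLHS]wmean_cst.
by apply: le_wmean => t' _.
Qed.

Let rho_ge t : 1 <= E * rho t.
Proof.
rewrite mulrA ler_pdivlMr// mul1r -[leRHS]wmean_cst.
by apply: le_wmean => t' _.
Qed.

Lemma sum_reweight_gt0 : 0 < \sum_t w t * r t.
Proof. by rewrite sum_wmean mulr_gt0. Qed.

Lemma wmean_reweightE u :
  wmean (fun t => w t * r t) u = wmean w (fun t => rho t * u t).
Proof.
rewrite [RHS](_ : _ = (wmean w r)^-1 * wmean w (fun t => r t * u t)); last first.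
  by rewrite -wmeanZ; apply: eq_wmean => t; ring.
have e : \sum_t w t * (r t * u t) = \sum_t w t * r t * u t.
  by apply: eq_bigr => t _; rewrite mulrA.
rewrite /wmean e; field.
by rewrite !gt_eqF// sum_reweight_gt0.
Qed.

Context (u : T -> R) (u_gt0 : forall t, 0 < u t).
Local Notation F := (wmean w u).
Local Notation U := (wmean (fun t => w t * r t) u).

Lemma wmean_reweight_le : U <= E * F.
Proof.
by rewrite wmean_reweightE -wmeanZ; apply: le_wmean => t _; rewrite ler_pM2r.
Qed.

Lemma wmean_le_reweight : F <= E * U.
Proof.
rewrite wmean_reweightE -wmeanZ; apply: le_wmean => t _.
by rewrite mulrA ler_peMl// ltW.
Qed.

(** Produces the hypothesis [H] of [cross_term_le]. [U - F] is the mean of [(rho - 1) (u - F)] with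
    [|rho - 1| <= E - 1], and Young's inequality bounds [|u - F|] by an entropy-like term plus a
    linear one. *)
Lemma wmean_reweight_dist s : 0 < s -> `|U - F| <=
  (E - 1) * (s * wmean w (fun t => (u t - F) * ln (u t)) / 2 + F / (2 * s)).
Proof.
move=> s0; have F0 : 0 < F by exact: wmean_gt0.
have -> : wmean w (fun t => (u t - F) * ln (u t)) =
    wmean w (fun t => (u t - F) * (ln (u t) - ln F)).
  rewrite [RHS](@eq_wmean _ _ (fun t => (u t - F) * ln (u t) - ln F * (u t - F))).
    by rewrite wmeanB wmeanZ wmeanB wmean_cst subrr mulr0 subr0.
  by move=> t; ring.
have UF : U - F = wmean w (fun t => (rho t - 1) * (u t - F)).
  rewrite [RHS](@eq_wmean _ _ (fun t => rho t * u t - u t - F * (rho t - 1))).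
    rewrite !wmeanB wmeanZ wmeanB wmean_cst -wmean_reweightE.
    rewrite (_ : wmean w rho = 1) ?subrr ?mulr0 ?subr0//.
    rewrite (@eq_wmean _ _ (fun t => (wmean w r)^-1 * r t)) => [|t]; last exact: mulrC.
    by rewrite wmeanZ mulVf ?gt_eqF.
  by move=> t; ring.
pose b t := (E - 1) * (s / 2 * ((u t - F) * (ln (u t) - ln F)) + (4 * s)^-1 * (u t + F)).
have bd t : `|(rho t - 1) * (u t - F)| <= b t.
  rewrite normrM /b; apply: ler_pM => //.
    rewrite ler_norml; have := rho_le t; have := rho_ge t => h1 h2.
    apply/andP; split; last by rewrite lerD2r.
    rewrite lerNl opprB.
    by apply: onem_le_subr1 => //; rewrite divr_gt0.
  have uF : 0 < u t + F by rewrite addr_gt0.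
  (* Young's inequality with weight [s]; the denominator [u t + F] is the one of the logarithmic
     mean inequality used next. *)
  apply: (@le_trans _ _ (s * (u t - F) ^+ 2 / (u t + F) + (4 * s)^-1 * (u t + F))).
    rewrite -(ler_pM2r (_ : 0 < 4 * s * (u t + F))) ?mulr_gt0//.
    rewrite [leRHS](_ : _ = 4 * s ^+ 2 * (u t - F) ^+ 2 + (u t + F) ^+ 2); last first.
      by field; rewrite !gt_eqF.
    have -> : 4 * s ^+ 2 * (u t - F) ^+ 2 = (2 * s * `|u t - F|) ^+ 2.
      by rewrite exprMn real_normK ?num_real//; ring.
    have := sqr_ge0 (2 * s * `|u t - F| - (u t + F)); lra.
  rewrite lerD2r ler_pdivrMr//.
  have := logmean_le_mean (u_gt0 t) F0 => /(ler_wpM2l (ltW s0)).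
  lra.
have bE : wmean w b = (E - 1) *
  (s * wmean w (fun t => (u t - F) * (ln (u t) - ln F)) / 2 + F / (2 * s)).
  rewrite /b wmeanZ wmeanD wmeanZ wmeanZ wmeanD wmean_cst; congr (_ * (_ + _)).
    by ring.
  by field; rewrite gt_eqF.
rewrite -bE UF ler_norml; apply/andP; split.
  rewrite -[leLHS]mulN1r -wmeanZ; apply: le_wmean => t _.
  by rewrite mulN1r lerNl; apply: le_trans (bd t); rewrite -normrN ler_norm.
by apply: le_wmean => t _; apply: le_trans (bd t); exact: ler_norm.
Qed.

End reweighting.

End weighted_mean.

(** * Two sites with reference weights mu and nu and interaction density g *)

Section two_sites.
Context {R : realType} {S T : finType}.
Context (mu : S -> R) (nu : T -> R) (g f : S -> T -> R) (E : R).
Hypotheses (mu_ge0 : forall a, 0 <= mu a) (mu_gt0 : 0 < \sum_a mu a).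
Hypotheses (nu_ge0 : forall c, 0 <= nu c) (nu_gt0 : 0 < \sum_c nu c).
Hypotheses (g_gt0 : forall a c, 0 < g a c) (f_gt0 : forall a c, 0 < f a c).
Hypotheses (E_ge1 : 1 <= E)
  (g_ratio : forall a b c d, g a c * g b d <= E * (g a d * g b c)).

Local Notation rowmean := (fun a => wmean (fun c => nu c * g a c) (f a)).
Local Notation colmean := (fun c => wmean (fun a => mu a * g a c) (f ^~ c)).
Local Notation z := (fun c => \sum_a mu a * g a c).
Local Notation y := (fun a => \sum_c nu c * g a c).
Local Notation K a :=
  (wmean (fun c => nu c * g a c) (fun c => (f a c - rowmean a) * ln (f a c))).
Local Notation kappa := (3 / 4 * (E * (E ^+ 2 - 1))).

Let sum_mul_gt0 (I : finType) (m h : I -> R) : (forall i, 0 <= m i) ->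
  0 < \sum_i m i -> (forall i, 0 < h i) -> 0 < \sum_i m i * h i.
Proof. by move=> m0 M0 h0; exact: (@sum_reweight_gt0 R I m m0 M0 h h0). Qed.

Let z_gt0 c : 0 < z c. Proof. exact: sum_mul_gt0. Qed.
Let y_gt0 a : 0 < y a. Proof. exact: sum_mul_gt0. Qed.

Let nug_ge0 a c : 0 <= nu c * g a c. Proof. by rewrite mulr_ge0// ltW. Qed.
Let mug_ge0 c a : 0 <= mu a * g a c. Proof. by rewrite mulr_ge0// ltW. Qed.

Let wcov_ge0 a : 0 <= K a.
Proof.
set F := rowmean a.
have F0 : 0 < F by apply: wmean_gt0.
have -> : K a = wmean (fun c => nu c * g a c)
    (fun c => (f a c - F) * (ln (f a c) - ln F)).
  rewrite [RHS](@eq_wmean _ _ _ _ (fun c => (f a c - F) * ln (f a c) - ln F * (f a c - F))).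
    by rewrite wmeanB wmeanZ wmeanB wmean_cst// subrr mulr0 subr0.
  by move=> c; ring.
rewrite -[leLHS](@wmean_cst _ _ (fun c => nu c * g a c))//.
apply: le_wmean => // c _.
exact: sub_lnB_ge0.
Qed.

(** The common law for comparing rows [a] and [b]: row [a] reweighted by [g b / z] is the same
    measure as row [b] reweighted by [g a / z]. *)
Local Notation q a b := (fun c => nu c * g a c * (g b c / z c)).

Let qC a b : q a b =1 q b a. Proof. by move=> c; ring. Qed.

Let ratio_gt0 b c : 0 < g b c / z c. Proof. exact: divr_gt0. Qed.

(** Sum the cross-ratio hypothesis against [mu] over the first site. *)
Let ratio_le b c d : g b c / z c <= E * (g b d / z d).
Proof.
suff : g b c * z d <= E * g b d * z c.
  move=> h; rewrite ler_pdivrMr//.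
  by have -> : E * (g b d / z d) * z c = E * g b d * z c / z d; [ring|rewrite ler_pdivlMr].
rewrite !mulr_sumr; apply: ler_sum => a _.
by have := ler_wpM2l (mu_ge0 a) (g_ratio b a c d); lra.
Qed.

(** Let [U], [V] be the [q]-means of the two rows. Then [(U - V) (ln (rowmean a) - ln (rowmean b))]
    is [(U - V) (ln U - ln V)], which Jensen's inequality compares with the subtracted term, plus
    two errors from replacing a row mean by [U] or [V]. Each error is bounded by [cross_term_le],
    with half of [kappa] in front of [(U - V) (ln U - ln V)]. *)
Let pair_le a b :
  \sum_c q a b c * ((f a c - f b c) * (ln (rowmean a) - ln (rowmean b)) -
    (f a c - f b c) * (ln (f a c) - ln (f b c))) <=
  kappa * \sum_c q a b c * ((f a c - f b c) * (ln (f a c) - ln (f b c))) +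
  kappa * (\sum_c q a b c * (K a + K b)).
Proof.
have q0 c : 0 <= q a b c by rewrite mulr_ge0// ltW.
have Q0 : 0 < \sum_c q a b c by apply: sum_reweight_gt0.
rewrite !(sum_wmean Q0) !(mulrCA kappa (\sum_c q a b c)) -mulrDr ler_pM2l//.
rewrite wmean_cst// wmeanB.
pose L := ln (rowmean a) - ln (rowmean b).
rewrite (@eq_wmean _ _ _ (fun c => _ * _) (fun c => L * (f a c - f b c))); last first.
  by move=> c; rewrite mulrC.
rewrite wmeanZ wmeanB.
have h1 : (forall s, 0 < s -> _) := wmean_reweight_dist (nug_ge0 a) (y_gt0 a) E_ge1
  (ratio_gt0 b) (ratio_le b) (f_gt0 a).
have h2 : (forall s, 0 < s -> _) := wmean_reweight_dist (nug_ge0 b) (y_gt0 b) E_ge1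
  (ratio_gt0 a) (ratio_le a) (f_gt0 b).
have eU : wmean (q b a) (f b) = wmean (q a b) (f b).
  by congr (wmean _ _); apply/funext/qC.
have hU1 := wmean_reweight_le (nug_ge0 a) (y_gt0 a) (ratio_gt0 b) (ratio_le b) (f_gt0 a).
have hU2 := wmean_le_reweight (nug_ge0 a) (y_gt0 a) (ratio_gt0 b) (ratio_le b) (f_gt0 a).
have hV1 := wmean_reweight_le (nug_ge0 b) (y_gt0 b) (ratio_gt0 a) (ratio_le a) (f_gt0 b).
have hV2 := wmean_le_reweight (nug_ge0 b) (y_gt0 b) (ratio_gt0 a) (ratio_le a) (f_gt0 b).
rewrite eU in h2 hV1 hV2.
have U0 : 0 < wmean (q a b) (f a) by exact: wmean_gt0.
have V0 : 0 < wmean (q a b) (f b) by exact: wmean_gt0.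
have Fa0 : 0 < rowmean a by exact: wmean_gt0.
have Fb0 : 0 < rowmean b by exact: wmean_gt0.
have c1 := cross_term_le E_ge1 (wcov_ge0 a) Fa0 U0 V0 hU1 hU2 h1.
have c2 := cross_term_le E_ge1 (wcov_ge0 b) Fb0 V0 U0 hV1 hV2 h2.
have J := sub_lnB_wmean q0 Q0 (f_gt0 a) (f_gt0 b).
have k0 : 0 <= kappa.
  have : 1 <= E ^+ 2 by rewrite exprn_ege1.
  move=> ?; apply: mulr_ge0; first by lra.
  by apply: mulr_ge0; rewrite ?subr_ge0//; move: E_ge1; lra.
have := ler_wpM2l k0 J.
move: c1 c2 J; rewrite /L; lra.
Qed.

(** Both sides become sums over pairs of rows weighted by [q], and [pair_le] applies to each
    pair. *)
Lemma two_site_bound :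
  \sum_a \sum_c mu a * nu c * g a c *
    ((f a c - colmean c) * (ln (rowmean a) - ln (f a c))) <=
  kappa * (\sum_a \sum_c mu a * nu c * g a c * ((f a c - colmean c) * ln (f a c)) +
           \sum_a \sum_c mu a * nu c * g a c * ((f a c - rowmean a) * ln (f a c))).
Proof.
(* For fixed [c] the left-hand side is a covariance under the column law, which [sum_wcov] turns
   into a sum over pairs [a], [b]. *)
have sym h : \sum_a \sum_c mu a * nu c * g a c * ((f a c - colmean c) * h a c) =
    2^-1 * \sum_a \sum_b mu a * mu b * \sum_c q a b c *
      ((f a c - f b c) * (h a c - h b c)).
  rewrite exchange_big/=.
  transitivity (\sum_c 2^-1 * (nu c / z c) * \sum_a \sum_b
     mu a * g a c * (mu b * g b c) * ((f a c - f b c) * (h a c - h b c))).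
    apply: eq_bigr => c _.
    transitivity (nu c * \sum_a mu a * g a c * ((f a c - colmean c) * h a c)).
      by rewrite mulr_sumr; apply: eq_bigr => a _; ring.
    rewrite sum_wcov//; set X := \sum_a \sum_b _; field.
    by rewrite gt_eqF.
  transitivity (\sum_c \sum_a \sum_b 2^-1 * (mu a * mu b * (q a b c *
      ((f a c - f b c) * (h a c - h b c))))).
    apply: eq_bigr => c _; rewrite mulr_sumr; apply: eq_bigr => a _.
    by rewrite mulr_sumr; apply: eq_bigr => b _; field; rewrite gt_eqF.
  rewrite exchange_big/= mulr_sumr; apply: eq_bigr => a _.
  rewrite exchange_big/= mulr_sumr; apply: eq_bigr => b _.
  by rewrite !mulr_sumr.
have := sym (fun a c => ln (rowmean a) - ln (f a c)) => /= ->.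
have := sym (fun a c => ln (f a c)) => /= ->.
(* Since [\sum_b mu b * g b c = z c], summing [mu b * q a b c] over [b] gives back the row weight
   [nu c * g a c]. The factor [2^-1] accounts for the two equal parts [K a] and [K b]. *)
have -> : \sum_a \sum_c mu a * nu c * g a c * ((f a c - rowmean a) * ln (f a c)) =
    2^-1 * \sum_a \sum_b mu a * mu b * \sum_c q a b c * (K a + K b).
  have e1 : \sum_a \sum_c mu a * nu c * g a c * ((f a c - rowmean a) * ln (f a c)) =
      \sum_a mu a * (y a * K a).
    apply: eq_bigr => a _; rewrite -sum_wmean// mulr_sumr.
    by apply: eq_bigr => c _; rewrite !mulrA.
  have e2 : \sum_a \sum_b mu a * mu b * \sum_c q a b c * K a = \sum_a mu a * (y a * K a).
    apply: eq_bigr => a _.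
    transitivity (\sum_b \sum_c mu a * K a * (nu c * g a c / z c) * (mu b * g b c)).
      apply: eq_bigr => b _; rewrite mulr_sumr; apply: eq_bigr => c _.
      by field; rewrite gt_eqF.
    rewrite exchange_big/=.
    transitivity (mu a * K a * y a); last by ring.
    rewrite mulr_sumr; apply: eq_bigr => c _; rewrite -mulr_sumr.
    by field; rewrite gt_eqF.
  have e3 : \sum_a \sum_b mu a * mu b * \sum_c q a b c * K b = \sum_a mu a * (y a * K a).
    rewrite -e2 exchange_big/=; apply: eq_bigr => a _; apply: eq_bigr => b _.
    rewrite [mu b * _]mulrC; congr (_ * _); apply: eq_bigr => c _.
    by rewrite qC.
  rewrite e1 -[LHS](mulKf (_ : (2 : R) != 0))//; congr (_ * _).
  rewrite mulrDl mul1r -{1}e2 -{1}e3 -big_split; apply: eq_bigr => a _ /=.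
  rewrite -big_split; apply: eq_bigr => b _ /=.
  rewrite -mulrDr -big_split; congr (_ * _); apply: eq_bigr => c _ /=.
  by rewrite -mulrDr.
rewrite -mulrDr mulrCA ler_pM2l ?invr_gt0// -big_split mulr_sumr.
apply: ler_sum => a _ /=; rewrite -big_split mulr_sumr; apply: ler_sum => b _ /=.
rewrite -mulrDr mulrCA ler_wpM2l ?mulr_ge0//.
have := pair_le a b; rewrite -mulrDr; apply: le_trans.
rewrite le_eqVlt; apply/orP; left; apply/eqP; apply: eq_bigr => c _.
by ring.
Qed.

End two_sites.

(** * Finite product spaces *)

Section coordinate_update.
Context {I S : finType}.
Local Notation X := {ffun I -> S}.
Implicit Types (x : X) (i k : I) (a b c : S).

Definition upd x i a : X := [ffun j => if j == i then a else x j].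

Lemma upd_same x i a : upd x i a i = a. Proof. by rewrite ffunE eqxx. Qed.

Lemma upd_id x i : upd x i (x i) = x.
Proof. by apply/ffunP => j; rewrite ffunE; case: eqP => // ->. Qed.

Lemma upd_upd x i a b : upd (upd x i a) i b = upd x i b.
Proof. by apply/ffunP => j; rewrite !ffunE; case: eqP. Qed.

Lemma updC x i k a c : i != k -> upd (upd x i a) k c = upd (upd x k c) i a.
Proof.
move=> ik; apply/ffunP => j; rewrite !ffunE.
by have [->|] := eqVneq j k; rewrite // eq_sym (negbTE ik).
Qed.

Context {R : realType}.
Implicit Types F : X -> R.

(** The map [(x, a) |-> (upd x i a, x i)] is an involution of configurations paired with values. *)
Lemma sum_upd i F : \sum_x \sum_a F (upd x i a) = #|S|%:R * \sum_x F x.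
Proof.
rewrite pair_big/=; pose swap (u : X * S) := (upd u.1 i u.2, u.1 i).
have swapK : involutive swap.
  by move=> [x a]; rewrite /swap/= upd_upd upd_id upd_same.
rewrite (reindex_inj (inv_inj swapK))/=.
under eq_bigr do rewrite upd_upd upd_id.
by rewrite -(pair_big xpredT xpredT (fun x _ => F x))/= mulr_sumr;
  apply: eq_bigr => x _; rewrite sumr_const mulr_natl.
Qed.

(* Averaging over the value at a site replaces a splitting of X as a product. *)
Lemma ler_sum_upd i F F' : (forall x, \sum_a F (upd x i a) <= \sum_a F' (upd x i a)) ->
  \sum_x F x <= \sum_x F' x.
Proof.
move=> FF'; have [S0|S0] := posnP #|S|.
  have X0 : xpredT =1 pred0 :> (X -> bool).
    by move=> x; have := fintype0 (x i) S0.
  by rewrite !(eq_bigl _ _ X0) !big_pred0_eq.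
rewrite -(ler_pM2l (_ : 0 < #|S|%:R)) ?ltr0n// -!(sum_upd i).
exact: ler_sum.
Qed.

Lemma ler_sum_upd2 i k F F' :
  (forall x, \sum_a \sum_c F (upd (upd x i a) k c) <=
             \sum_a \sum_c F' (upd (upd x i a) k c)) ->
  \sum_x F x <= \sum_x F' x.
Proof.
move=> FF'; have [S0|S0] := posnP #|S|.
  by apply: (@ler_sum_upd i) => x; have := fintype0 (x i) S0.
rewrite -(ler_pM2l (_ : 0 < #|S|%:R)) ?ltr0n// -!(sum_upd k).
exact: ler_sum_upd FF'.
Qed.

Lemma eq_sum_upd i F F' : (forall x, \sum_a F (upd x i a) = \sum_a F' (upd x i a)) ->
  \sum_x F x = \sum_x F' x.
Proof.
by move=> FF'; apply/eqP; rewrite eq_le; apply/andP; split;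
  apply: (@ler_sum_upd i) => x; rewrite FF'.
Qed.

End coordinate_update.

(** * Entropy and conditional entropies of a finite Gibbs weight *)

Section finite_tensorization.
Context {R : realType} {I S : finType}.
Local Notation X := {ffun I -> S}.
Context (m : I -> S -> R) (G : X -> R).
Hypotheses (m_ge0 : forall i a, 0 <= m i a) (m_gt0 : forall i, 0 < \sum_a m i a)
  (G_gt0 : forall x, 0 < G x).
Implicit Types (f h : X -> R) (x : X) (i k : I) (a b c d : S).

Definition mass x : R := (\prod_i m i (x i)) * G x.

Definition cond k f x : R :=
  wmean (fun a => m k a * G (upd x k a)) (fun a => f (upd x k a)).

Lemma mass_ge0 x : 0 <= mass x.
Proof. by rewrite mulr_ge0 ?prodr_ge0// ltW. Qed.

Lemma mass_upd x k a :
  mass (upd x k a) = (\prod_(i | i != k) m i (x i)) * (m k a * G (upd x k a)).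
Proof.
rewrite /mass (bigD1 k)//= upd_same mulrAC mulrC; congr (_ * _).
by apply: eq_bigr => i ik; rewrite ffunE (negbTE ik).
Qed.

Lemma mass_gt0 x : (0 < mass x) = [forall i, 0 < m i (x i)].
Proof.
rewrite pmulr_lgt0//; apply/idP/forallP => [x0 i|x0]; last by rewrite prodr_gt0.
rewrite lt_neqAle m_ge0 andbT eq_sym; apply/eqP => mi0.
by move: x0; rewrite (bigD1 i)//= mi0 mul0r ltxx.
Qed.

Let w_ge0 k x a : 0 <= m k a * G (upd x k a).
Proof. by rewrite mulr_ge0// ltW. Qed.

Let w_gt0 k x : 0 < \sum_a m k a * G (upd x k a).
Proof. exact: (@sum_reweight_gt0 _ _ (m k)). Qed.

Lemma cond_upd k f x a : cond k f (upd x k a) = cond k f x.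
Proof.
rewrite /cond; under eq_fun do rewrite upd_upd.
by congr wmean; apply/funext => b; rewrite upd_upd.
Qed.

Lemma cond_gt0 k f x : (forall y, 0 < f y) -> 0 < cond k f x.
Proof. by move=> f0; apply: wmean_gt0. Qed.

Lemma condD k f h x : cond k (fun y => f y + h y) x = cond k f x + cond k h x.
Proof. exact: wmeanD. Qed.

Lemma condZ k r h x : cond k (fun y => r * h y) x = r * cond k h x.
Proof. exact: wmeanZ. Qed.

(** The tower property: with the other coordinates frozen, [h] is constant and the sum over the
    value at [k] is the one defining [cond k f]. *)
Lemma sum_cond k f h : (forall x a, h (upd x k a) = h x) ->
  \sum_x mass x * (cond k f x * h x) = \sum_x mass x * (f x * h x).
Proof.
move=> hk; apply: (@eq_sum_upd _ _ _ k) => x.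
transitivity ((\prod_(i | i != k) m i (x i)) * h x *
   ((\sum_a m k a * G (upd x k a)) * cond k f x)).
  rewrite mulr_suml mulr_sumr; apply: eq_bigr => a _.
  by rewrite mass_upd cond_upd hk; ring.
rewrite /cond -sum_wmean// mulr_sumr; apply: eq_bigr => a _.
by rewrite mass_upd hk; ring.
Qed.

(** The rate at which entropy dissipates when coordinate [k] is resampled. *)
Definition dirichlet k f : R := \sum_x mass x * ((f x - cond k f x) * ln (f x)).

Definition cond_ent k f : R :=
  \sum_x mass x * (f x * ln (f x) - cond k f x * ln (cond k f x)).

(** As [mass] is not normalised, the mean inside the logarithm is divided by the total mass; the
    result is the total mass times the entropy under the normalised law. *)
Definition fent f : R := \sum_x mass x * (f x * ln (f x)) -
  (\sum_x mass x * f x) * ln ((\sum_x mass x * f x) / \sum_x mass x).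

(** [f - cond k f] is orthogonal to functions that do not depend on coordinate [k], such as
    [ln (cond k f)]. In this form every summand is nonnegative for positive [f]. *)
Lemma dirichletE k f :
  dirichlet k f = \sum_x mass x * ((f x - cond k f x) * (ln (f x) - ln (cond k f x))).
Proof.
apply/esym/eqP; rewrite -subr_eq0 -sumrB.
have := @sum_cond k f (fun x => ln (cond k f x)).
move=> /(_ (fun x a => congr1 _ (cond_upd k f x a)))/eqP; rewrite -subr_eq0 -sumrB.
by apply: etrans; congr (_ == _); apply: eq_bigr => x _; ring.
Qed.

Lemma dirichlet_ge0 k f : (forall x, 0 < f x) -> 0 <= dirichlet k f.
Proof.
move=> f0; rewrite dirichletE sumr_ge0// => x _.
by rewrite mulr_ge0 ?mass_ge0 ?sub_lnB_ge0 ?cond_gt0.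
Qed.

Lemma dirichlet_eq0 k f x : (forall x, 0 < f x) -> dirichlet k f = 0 ->
  0 < mass x -> f x = cond k f x.
Proof.
move=> f0 /eqP; rewrite dirichletE psumr_eq0 => [/allP/(_ x)|y _].
  rewrite mem_index_enum => /(_ isT)/eqP/eqP; rewrite mulf_eq0 => /orP[/eqP->|/eqP h _].
    by rewrite ltxx.
  by apply: sub_lnB_eq0 h => //; exact: cond_gt0.
by rewrite mulr_ge0 ?mass_ge0 ?sub_lnB_ge0 ?cond_gt0.
Qed.

(** Induction on the number of coordinates where [x] and [y] differ. Moving one coordinate of [x] to
    its value in [y] keeps the mass positive, because the support is a product set, and keeps [f],
    because [f = cond k f] on the support. *)
Lemma dirichlet_eq0_cst f : (forall x, 0 < f x) -> (forall k, dirichlet k f = 0) ->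
  forall x y, 0 < mass x -> 0 < mass y -> f x = f y.
Proof.
move=> f0 D0 x y; have [n] := ubnP #|[pred i | x i != y i]|.
elim: n x => // n IH x; rewrite ltnS => xyn x0 y0.
have [k /= xyk|xy] := pickP [pred i | x i != y i]; last first.
  by congr f; apply/ffunP => i; apply/eqP/negbFE; exact: xy.
pose z := upd x k (y k).
have z0 : 0 < mass z.
  move: x0 y0; rewrite !mass_gt0 => /forallP x0 /forallP y0; apply/forallP => i.
  by rewrite ffunE; case: eqP => [->|].
have -> : f x = f z by rewrite (dirichlet_eq0 f0 (D0 k) x0)
   (dirichlet_eq0 f0 (D0 k) z0) cond_upd.
apply: IH => //; apply: leq_trans xyn; apply: proper_card; apply/fintype.properP; split.
  by apply/fintype.subsetP => i; rewrite !inE ffunE; have [->|//] := eqVneq i k; rewrite eqxx.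
by exists k; rewrite !inE// upd_same eqxx.
Qed.

Context (E : I -> I -> R).
Hypotheses (E_ge1 : forall i k, 1 <= E i k) (E_sym : forall i k, E i k = E k i)
  (G_ratio : forall i k x a b c d, i != k ->
    G (upd (upd x i a) k c) * G (upd (upd x i b) k d) <=
    E i k * (G (upd (upd x i a) k d) * G (upd (upd x i b) k c))).

Local Notation kappa i k := (3 / 4 * (E i k * (E i k ^+ 2 - 1))).

Lemma cross_dirichlet_le i k f : (forall x, 0 < f x) -> i != k ->
  \sum_x mass x * ((f x - cond i f x) * (ln (cond k f x) - ln (f x))) <=
  kappa i k * (dirichlet i f + dirichlet k f).
Proof.
move=> f0 ik; rewrite /dirichlet -big_split mulr_sumr.
apply: (@ler_sum_upd2 _ _ _ i k) => x /=.
pose y a c := upd (upd x i a) k c.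
pose P := \prod_(j | (j != i) && (j != k)) m j (x j).
have massE a c : mass (y a c) = P * (m i a * m k c * G (y a c)).
  rewrite /y mass_upd (bigD1 i)//= upd_same /P.
  rewrite (@eq_bigl _ _ _ _ _ _ (fun j => (j != i) && (j != k))); last first.
    by move=> j; rewrite andbC.
  rewrite (@eq_bigr _ _ _ _ _ _ _ (fun j => m j (x j))); first by ring.
  by move=> j /andP[/negbTE ji _]; rewrite ffunE ji.
have condi a c : cond i f (y a c) =
    wmean (fun a => m i a * G (y a c)) (fun a => f (y a c)).
  rewrite /cond /y; congr wmean; apply/funext => b;
    by rewrite (updC _ _ _ ik) upd_upd -updC.
have condk a c : cond k f (y a c) =
    wmean (fun c => m k c * G (y a c)) (fun c => f (y a c)).
  by rewrite /cond /y; congr wmean; apply/funext => b; rewrite upd_upd.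
have := @two_site_bound R S S (m i) (m k) (fun a c => G (y a c))
  (fun a c => f (y a c)) (E i k) (m_ge0 i) (m_gt0 i) (m_ge0 k) (m_gt0 k)
  (fun _ _ => G_gt0 _) (fun _ _ => f0 _) (E_ge1 i k)
  (fun a b c d => G_ratio x a b c d ik).
have P0 : 0 <= P by rewrite prodr_ge0.
move=> /(ler_wpM2l P0); rewrite mulrCA -big_split !mulr_sumr => H.
apply: le_trans (le_trans _ H) _; rewrite le_eqVlt; apply/orP; left; apply/eqP.
  apply: eq_bigr => a _; rewrite mulr_sumr; apply: eq_bigr => c _.
  by rewrite massE condi condk; ring.
apply: eq_bigr => a _ /=; rewrite -big_split !mulr_sumr; apply: eq_bigr => c _ /=.
by rewrite massE condi condk; ring.
Qed.

Definition drift f x : R := \sum_i (cond i f x - f x).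

Context (q : R) (influence_le : forall i, \sum_(k | k != i) E i k * (E i k ^+ 2 - 1) <= q).

Lemma sum_drift_ln f : \sum_x mass x * (drift f x * ln (f x)) = - \sum_i dirichlet i f.
Proof.
rewrite /dirichlet exchange_big -sumrN/=; apply: eq_bigr => x _.
rewrite -mulr_sumr -mulrN -mulr_suml -mulNr -sumrN; congr (_ * (_ * _)).
by apply: eq_bigr => i _; rewrite opprB.
Qed.

(** The terms [i = k] give [- dirichlet k f]. The others are two-site errors; by symmetry of [E]
    each [dirichlet i f] is charged twice, at most [3 / 4 * q] each time. *)
Lemma sum_drift_cond f : (forall x, 0 < f x) ->
  \sum_k \sum_x mass x * (drift f x * (ln (f x) - ln (cond k f x))) <=
  - (1 - 3 / 2 * q) * \sum_i dirichlet i f.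
Proof.
move=> f0.
pose D i := dirichlet i f.
pose A i k := \sum_x mass x * ((f x - cond i f x) * (ln (cond k f x) - ln (f x))).
have -> : \sum_k \sum_x mass x * (drift f x * (ln (f x) - ln (cond k f x))) =
    \sum_k \sum_i A i k.
  apply: eq_bigr => k _; rewrite exchange_big/=; apply: eq_bigr => x _.
  rewrite -mulr_sumr -mulr_suml -[drift f x * _]mulrNN opprB /drift -sumrN.
  by congr (_ * (_ * _)); apply: eq_bigr => i _; rewrite opprB.
have Akk k : A k k = - D k.
  rewrite /D dirichletE -sumrN; apply: eq_bigr => x _; ring.
have D0 i : 0 <= D i by exact: dirichlet_ge0.
have kD : \sum_k \sum_(i | i != k) kappa k i * D k <= 3 / 4 * q * \sum_i D i.
  rewrite mulr_sumr; apply: ler_sum => k _; rewrite -mulr_suml ler_wpM2r//.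
  by rewrite -mulr_sumr ler_wpM2l.
have kD' : \sum_k \sum_(i | i != k) kappa i k * D i =
    \sum_k \sum_(i | i != k) kappa k i * D k.
  rewrite (exchange_big_dep xpredT)//=; apply: eq_bigr => i _.
  by apply: eq_bigl => k; rewrite eq_sym.
apply: (@le_trans _ _ (\sum_k (- D k + \sum_(i | i != k) kappa i k * (D i + D k)))).
  apply: ler_sum => k _; rewrite (bigD1 k)//= Akk lerD2l; apply: ler_sum => i ik.
  exact: cross_dirichlet_le.
rewrite big_split sumrN/=.
have -> : \sum_k \sum_(i | i != k) kappa i k * (D i + D k) =
    \sum_k \sum_(i | i != k) kappa i k * D i + \sum_k \sum_(i | i != k) kappa k i * D k.
  rewrite -big_split; apply: eq_bigr => k _; rewrite -big_split; apply: eq_bigr => i _ /=.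
  by rewrite mulrDr (E_sym k i).
rewrite kD'; move: kD; rewrite -/D; lra.
Qed.

Lemma cond_drift_step f k s x : cond k (fun y => f y + s * drift f y) x =
  cond k f x + s * cond k (drift f) x.
Proof. by rewrite condD condZ. Qed.

Let mass_total_gt0 : 0 < \sum_x mass x.
Proof.
have ex i := psum_gt0_ex (m_ge0 i) (m_gt0 i).
pose x : X := [ffun i => xchoose (ex i)].
have x0 : 0 < mass x.
  by rewrite mass_gt0; apply/forallP => i; rewrite ffunE; exact: (xchooseP (ex i)).
by rewrite (bigD1 x)//= ltr_pwDl// sumr_ge0// => y _; exact: mass_ge0.
Qed.

(** The tangent-line inequality for [x ln x] at [cond k f]; its linear part sums to 0 by
    [sum_cond]. *)
Lemma cond_ent_ge0 k f : (forall x, 0 < f x) -> 0 <= cond_ent k f.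
Proof.
move=> f0; have e : \sum_x mass x * (f x * 1) = \sum_x mass x * (cond k f x * 1).
  by rewrite sum_cond.
have e' := @sum_cond k f (fun x => ln (cond k f x)) (fun x a => congr1 _ (cond_upd k f x a)).
rewrite (_ : cond_ent k f = \sum_x mass x *
  (f x * ln (f x) - (cond k f x * ln (cond k f x) + (f x - cond k f x) *
     (ln (cond k f x) + 1)))).
  apply: sumr_ge0 => x _; rewrite mulr_ge0 ?mass_ge0// subr_ge0.
  by apply: xlnx_tangent_le => //; exact: cond_gt0.
apply/eqP; rewrite -subr_eq0 -sumrB.
have : \sum_x mass x * (f x * 1) - \sum_x mass x * (cond k f x * 1) +
  (\sum_x mass x * (f x * ln (cond k f x)) -
   \sum_x mass x * (cond k f x * ln (cond k f x))) == 0.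
  by rewrite e e' !subrr addr0.
rewrite -!sumrB -big_split; apply: etrans; congr (_ == _).
by apply: eq_bigr => x _ /=; ring.
Qed.

(** * First-order analysis at a minimiser *)

Section minimiser.
Context (C : R) (f : X -> R).
Hypotheses (C_ge0 : 0 <= C) (f_gt0 : forall x, 0 < f x).
Local Notation Phi f := (C * (\sum_k cond_ent k f) - fent f).

(** Bound [f ln f] from above to second order and [cond k f * ln (cond k f)] from below by its
    tangent. In the first-order terms [cond k (drift f)] may be replaced by [drift f], and the
    constants 1 cancel. *)
Lemma cond_ent_step k s : 0 < s -> (forall x, 0 < f x + s * drift f x) ->
  cond_ent k (fun x => f x + s * drift f x) <= cond_ent k f +
  s * (\sum_x mass x * (drift f x * (ln (f x) - ln (cond k f x)))) +
  s ^+ 2 * (\sum_x mass x * (drift f x ^+ 2 / f x)).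
Proof.
move=> s0 fs0.
pose hk := cond k (drift f).
have e1 : \sum_x mass x * (drift f x * ln (cond k f x)) =
    \sum_x mass x * (hk x * ln (cond k f x)).
  by rewrite /hk sum_cond// => x a; rewrite cond_upd.
have e2 : \sum_x mass x * drift f x = \sum_x mass x * hk x.
  have := @sum_cond k (drift f) (fun=> 1) (fun _ _ => erefl).
  under eq_bigr do rewrite mulr1.
  by under [X in _ = X -> _]eq_bigr do rewrite mulr1.
apply: (@le_trans _ _ (\sum_x mass x * (
  f x * ln (f x) + s * drift f x * (ln (f x) + 1) + s ^+ 2 * (drift f x ^+ 2 / f x)
  - (cond k f x * ln (cond k f x) + s * hk x * (ln (cond k f x) + 1))))).
  apply: ler_sum => x _; rewrite ler_wpM2l ?mass_ge0// cond_drift_step.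
  apply: lerB.
    have := xlnx_tangent_ge (f_gt0 x) (fs0 x).
    rewrite [f x + _ - f x]addrAC subrr add0r => h; apply: le_trans h _.
    by rewrite le_eqVlt; apply/orP; left; apply/eqP; ring.
  have /xlnx_tangent_le := cond_gt0 k x f_gt0.
  have : 0 < cond k f x + s * hk x by rewrite -cond_drift_step; exact: cond_gt0.
  move=> h /(_ _ h); rewrite [cond k f x + _ - _]addrAC subrr add0r; exact.
rewrite /cond_ent le_eqVlt; apply/orP; left; apply/eqP.
transitivity (cond_ent k f +
  s * (\sum_x mass x * (drift f x * (ln (f x) - ln (cond k f x)))) +
  s ^+ 2 * (\sum_x mass x * (drift f x ^+ 2 / f x)) +
  (s * (\sum_x mass x * drift f x - \sum_x mass x * hk x) +
   s * (\sum_x mass x * (drift f x * ln (cond k f x)) -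
        \sum_x mass x * (hk x * ln (cond k f x))))); last first.
  by rewrite e1 e2 !subrr mulr0 !addr0.
rewrite -!sumrB !mulr_sumr -!big_split/=.
by apply: eq_bigr => x _; ring.
Qed.

(** The drift has total mass 0, so the mean of [f] and with it the second term of [fent] stay fixed;
    the first term lies above its tangent. *)
Lemma fent_step s : (forall x, 0 < f x + s * drift f x) ->
  fent f + s * (\sum_x mass x * (drift f x * ln (f x))) <=
  fent (fun x => f x + s * drift f x).
Proof.
move=> fs0.
have d0 : \sum_x mass x * drift f x = 0.
  rewrite /drift; under eq_bigr do rewrite mulr_sumr.
  rewrite exchange_big/= big1// => i _.
  have := @sum_cond i f (fun=> 1) (fun _ _ => erefl).
  move/eqP; rewrite -subr_eq0 -sumrB => /eqP; apply: etrans; apply: eq_bigr => x _.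
  by ring.
have m0 : \sum_x mass x * (f x + s * drift f x) = \sum_x mass x * f x.
  transitivity (\sum_x mass x * f x + s * \sum_x mass x * drift f x); last first.
    by rewrite d0 mulr0 addr0.
  rewrite mulr_sumr -big_split.
  by apply: eq_bigr => x _ /=; ring.
rewrite /fent m0 addrAC lerD2r.
have -> : s * (\sum_x mass x * (drift f x * ln (f x))) =
    s * (\sum_x mass x * (drift f x * ln (f x))) + s * (\sum_x mass x * drift f x).
  by rewrite d0 mulr0 addr0.
rewrite !mulr_sumr -!big_split; apply: ler_sum => x _ /=.
have := xlnx_tangent_le (f_gt0 x) (fs0 x).
rewrite [f x + _ - f x]addrAC subrr add0r => /(ler_wpM2l (mass_ge0 x)).
apply: le_trans; rewrite le_eqVlt; apply/orP; left; apply/eqP; ring.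
Qed.

(** Minimality bounds [(C (1 - 3 q / 2) - 1) D] by [s M] for every small [s], so the sum [D] of the
    Dirichlet terms vanishes. Then [f] is constant on the support and its entropy is 0. *)
Lemma minimiser_fent_le (s0 : R) : 0 < s0 -> 1 < C * (1 - 3 / 2 * q) ->
  (forall s, 0 < s -> s <= s0 -> (forall x, 0 < f x + s * drift f x) /\
     Phi f <= Phi (fun x => f x + s * drift f x)) ->
  0 <= Phi f.
Proof.
move=> s00 Cq min.
pose D := \sum_i dirichlet i f.
have D0 : 0 <= D by apply: sumr_ge0 => i _; exact: dirichlet_ge0.
pose M := C * (\sum_(k : I) \sum_x mass x * (drift f x ^+ 2 / f x)).
have step s : 0 < s -> s <= s0 -> (C * (1 - 3 / 2 * q) - 1) * D <= s * M.
  move=> s_gt0 ss0; have [fs0] := min s s_gt0 ss0.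
  have h1 : \sum_k cond_ent k (fun x => f x + s * drift f x) <=
      \sum_k (cond_ent k f + s * (\sum_x mass x * (drift f x * (ln (f x) - ln (cond k f x)))) +
        s ^+ 2 * (\sum_x mass x * (drift f x ^+ 2 / f x))).
    by apply: ler_sum => k _; exact: cond_ent_step.
  rewrite !big_split/= -!mulr_sumr in h1.
  have h2 := fent_step fs0; rewrite sum_drift_ln -/D in h2.
  have h3 := sum_drift_cond f_gt0; rewrite -/D in h3.
  have h4 := ler_wpM2l C_ge0 h1; rewrite !mulrDr in h4.
  have h5 := ler_wpM2l (mulr_ge0 C_ge0 (ltW s_gt0)) h3.
  have e : C * (s ^+ 2 * \sum_(k : I) \sum_x mass x * (drift f x ^+ 2 / f x)) = s * (s * M).
    by rewrite /M; ring.
  rewrite e in h4.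
  move=> h6; rewrite -(ler_pM2l s_gt0); nra.
have D_eq0 : D = 0.
  clearbody M.
  apply/eqP; rewrite eq_le D0 andbT leNgt; apply/negP => Dgt0.
  have P0 : 0 < (C * (1 - 3 / 2 * q) - 1) * D by rewrite mulr_gt0// subr_gt0.
  have [M0|M0] := leP M 0.
    have := step s0 s00 (lexx _); rewrite leNgt (le_lt_trans _ P0)//.
    by rewrite mulr_ge0_le0// ltW.
  (* With this [s] the error [s M] is at most half of the positive first-order gain. *)
  pose s := Num.min s0 ((C * (1 - 3 / 2 * q) - 1) * D / (2 * M)).
  have s_gt0 : 0 < s by rewrite lt_min s00 divr_gt0// mulr_gt0.
  have := step s s_gt0; rewrite ge_min lexx => /(_ isT).
  have : s <= (C * (1 - 3 / 2 * q) - 1) * D / (2 * M) by rewrite ge_min lexx orbT.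
  rewrite ler_pdivlMr ?mulr_gt0//; move: P0; lra.
have Dk0 k : dirichlet k f = 0.
  move/eqP: D_eq0; rewrite psumr_eq0 => [/allP/(_ k)|i _]; last exact: dirichlet_ge0.
  by rewrite mem_index_enum => /(_ isT)/eqP.
have fcst := dirichlet_eq0_cst f_gt0 Dk0.
rewrite subr_ge0; apply: (@le_trans _ _ 0); last first.
  by rewrite mulr_ge0// sumr_ge0// => k _; exact: cond_ent_ge0.
have [x0 x0_gt0] := psum_gt0_ex mass_ge0 mass_total_gt0.
have fx (h : R -> R) : \sum_x mass x * h (f x) = (\sum_x mass x) * h (f x0).
  rewrite mulr_suml; apply: eq_bigr => x _.
  have [<-|xn0] := eqVneq 0 (mass x); first by rewrite !mul0r.
  by rewrite (fcst x x0)// lt_neqAle xn0 mass_ge0.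
rewrite /fent (fx (fun t => t * ln t)) (fx id).
rewrite /= (_ : _ * f x0 / _ = f x0); last by field; rewrite gt_eqF.
by rewrite mulrA subrr.
Qed.

End minimiser.

(** Functions on [X] are viewed as row vectors in order to minimise over a compact box. *)
Let of_row (v : 'rV[R]_#|{: X}|) : X -> R := fun x => v ord0 (enum_rank x).

Let Phi_continuous C (v : 'rV[R]_#|{: X}|) : (forall x, 0 < of_row v x) ->
  {for v, continuous (fun u => C * (\sum_k cond_ent k (of_row u)) - fent (of_row u))}.
Proof.
move=> v0.
have csum (J : finType) (h : J -> 'rV[R]_#|{: X}| -> R) :
    (forall j, {for v, continuous (h j)}) ->
    {for v, continuous (fun u => \sum_j h j u)}.
  move=> hc; apply: (@cvg_big _ _ _ _ _ add_continuous _ (nbhs v) _ _ _ (nbhs_filter v)).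
    by move=> j _; exact: hc.
have cmul (h h' : 'rV[R]_#|{: X}| -> R) : {for v, continuous h} ->
    {for v, continuous h'} -> {for v, continuous (fun u => h u * h' u)}.
  by move=> hc hc'; exact: (continuousM hc hc').
have csub (h h' : 'rV[R]_#|{: X}| -> R) : {for v, continuous h} ->
    {for v, continuous h'} -> {for v, continuous (fun u => h u - h' u)}.
  by move=> hc hc'; exact: (continuousB hc hc').
have ccst (r : R) : {for v, continuous (fun=> r : R)} by exact: cst_continuous.
have cln (h : 'rV[R]_#|{: X}| -> R) : 0 < h v -> {for v, continuous h} ->
    {for v, continuous (fun u => ln (h u))}.
  by move=> h0 hc; apply: continuous_comp => //; exact: continuous_ln.
have ccoord x : {for v, continuous (of_row^~ x)} by exact: coord_continuous.
have ccond k x : {for v, continuous (fun u => cond k (of_row u) x)}.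
  by apply: (cmul _ _ _ _) => //; apply: (csum _ _) => a; exact: cmul.
have csm : {for v, continuous (fun u => \sum_x mass x * of_row u x)}.
  by apply: (csum _ _) => x; exact: cmul.
apply: (csub _ _ _ _).
  apply: (cmul _ _ _ _) => //; apply: (csum _ _) => k; apply: (csum _ _) => x.
  apply: (cmul _ _ _ _) => //; apply: (csub _ _ _ _).
    by apply: (cmul _ _ _ _) => //; exact: cln.
  by apply: (cmul _ _ _ _) => //; apply: cln => //; exact: cond_gt0.
apply: (csub _ _ _ _).
  apply: (csum _ _) => x; apply: (cmul _ _ _ _) => //.
  by apply: (cmul _ _ _ _) => //; exact: cln.
apply: (cmul _ _ _ _) => //; apply: (cln _ _ _); last exact: cmul.
apply: wmean_gt0 => //; exact: mass_ge0.
Qed.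

Lemma fent_le_sum_cond_ent f : q < 2 / 3 -> (forall x, 0 < f x) ->
  (1 - 3 / 2 * q) * fent f <= \sum_k cond_ent k f.
Proof.
move=> q23 f0.
have p0 : 0 < 1 - 3 / 2 * q by lra.
rewrite -ler_pdivlMl//.
have main C : 1 < C * (1 - 3 / 2 * q) -> fent f <= C * \sum_k cond_ent k f.
  move=> Cq; have C0 : 0 <= C by rewrite -(pmulr_lge0 _ p0) ltW// (lt_trans ltr01).
  (* Any positive bounds on [f] would do; these sums avoid choosing extremal points. *)
  pose hi := \sum_x f x; pose lo := (\sum_x (f x)^-1)^-1.
  have f_hi x : f x <= hi.
    by rewrite /hi (bigD1 x)//= lerDl sumr_ge0// => y _; exact: ltW.
  have lo_f x : lo <= f x.
    rewrite -[leRHS]invrK lef_pV2 ?posrE ?invr_gt0//; last first.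
      rewrite (bigD1 x)//= ltr_pwDl ?invr_gt0// sumr_ge0// => y _.
      by rewrite invr_ge0 ltW.
    by rewrite (bigD1 x)//= lerDl sumr_ge0// => y _; rewrite invr_ge0 ltW.
  have X0 : (0 < #|{: X}|)%N.
    rewrite lt0n; apply/eqP => X0; move: mass_total_gt0.
    by rewrite big1 ?ltxx// => x; have := fintype0 x X0.
  have lo0 : 0 < lo.
    case/card_gt0P: X0 => x _; rewrite invr_gt0 (bigD1 x)//= ltr_pwDl ?invr_gt0//.
    by rewrite sumr_ge0// => y _; rewrite invr_ge0 ltW.
  pose K := [set v : 'rV[R]_#|{: X}| | forall j, `[lo, hi]%classic (v ord0 j)].
  have cK : compact K.
    by apply: (@rV_compact R _ (fun=> `[lo, hi]%classic)) => j; exact: segment_compact.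
  pose to_row (h : X -> R) : 'rV[R]_#|{: X}| := \row_j h (enum_val j).
  have to_rowK h : of_row (to_row h) = h.
    by apply/funext => x; rewrite /of_row mxE enum_rankK.
  have to_rowP h : (forall x, lo <= h x <= hi) -> K (to_row h).
    by move=> hb j; rewrite mxE /= in_itv/=.
  have K0 : K !=set0 by exists (to_row f); apply: to_rowP => x; rewrite lo_f f_hi.
  have cPhi : {within K, continuous (fun u : 'rV[R]_#|{: X}| =>
      C * (\sum_k cond_ent k (of_row u)) - fent (of_row u))}.
    apply: continuous_in_subspaceT => v; rewrite inE => Kv; apply: Phi_continuous => x.
    by have := Kv (enum_rank x); rewrite /= in_itv/= => /andP[+ _]; exact: lt_le_trans.
  have [v] := compact_EVT_min K0 cK cPhi; rewrite inE => Kv vmin.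
  have vb x : lo <= of_row v x <= hi.
    by have := Kv (enum_rank x); rewrite /= in_itv.
  have v0 x : 0 < of_row v x by have /andP[+ _] := vb x; exact: lt_le_trans.
  have : 0 <= C * (\sum_k cond_ent k (of_row v)) - fent (of_row v).
    (* If [s * #|I| <= 1], the moved function is a convex combination of [of_row v] and its
       conditional means, so it stays in the box; [#|I|.+1] also covers empty [I]. *)
    apply: (@minimiser_fent_le C (of_row v) C0 v0 (#|I|.+1%:R)^-1) => //.
    move=> s s0 ss.
    have sb x : lo <= of_row v x + s * drift (of_row v) x <= hi.
      have -> : of_row v x + s * drift (of_row v) x = (1 - s * #|I|%:R) * of_row v x +
          s * \sum_i cond i (of_row v) x.
        by rewrite /drift sumrB sumr_const -mulr_natl; ring.
      have sN : 0 <= 1 - s * #|I|%:R.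
        rewrite subr_ge0; apply: (@le_trans _ _ (s * #|I|.+1%:R)).
          by rewrite ler_wpM2l ?ler_nat// ltW.
        by rewrite -ler_pdivlMr ?div1r.
      have /andP[h1 h2] := vb x.
      have c1 : lo * #|I|%:R <= \sum_i cond i (of_row v) x.
        rewrite mulr_natr -sumr_const; apply: ler_sum => i _.
        by apply: wmean_lb => // a; have /andP[] := vb (upd x i a).
      have c2 : \sum_i cond i (of_row v) x <= hi * #|I|%:R.
        rewrite mulr_natr -sumr_const; apply: ler_sum => i _.
        by apply: wmean_ub => // a; have /andP[] := vb (upd x i a).
      have := ler_wpM2l sN h1; have := ler_wpM2l sN h2.
      have := ler_wpM2l (ltW s0) c1; have := ler_wpM2l (ltW s0) c2.
      by move=> ? ? ? ?; apply/andP; split; lra.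
    split=> [x|]; first by have /andP[+ _] := sb x; exact: lt_le_trans.
    by have := vmin (to_row (fun x => of_row v x + s * drift (of_row v) x));
      rewrite inE to_rowK; apply; exact: to_rowP.
  have := vmin (to_row f); rewrite inE to_rowK => vf v_ge0.
  rewrite -subr_ge0; apply: le_trans v_ge0 (vf _).
  by apply: to_rowP => x; rewrite lo_f f_hi.
apply/ler_addgt0Pr => e e0.
pose D := \sum_k cond_ent k f.
have D0 : 0 <= D by apply: sumr_ge0 => k _; exact: cond_ent_ge0.
have D1 : 0 < D + 1 by rewrite ltr_wpDl.
(* A [C] above the critical value by so little that [C * D] grows by at most [e]; [D + 1] keeps the
   denominator positive. *)
have := main ((1 - 3 / 2 * q)^-1 + e / (D + 1)).
rewrite mulrDl mulVf ?gt_eqF// ltrDl => /(_ (mulr_gt0 (divr_gt0 e0 D1) p0)).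
move=> h; apply: le_trans h _; rewrite -/D mulrDl lerD2l.
by rewrite mulrAC ler_pdivrMr// ler_wpM2l ?lerDl// ltW.
Qed.

End finite_tensorization.

(** * Countable spaces *)

Section xlnx.
Context {R : realType}.
Implicit Types u v t e : R.

(* Integrand of the variational formula for the entropy. *)
Definition relent u t : R := u * ln u - u * ln t - u + t.

Lemma relent_ge0 u t : 0 <= u -> 0 < t -> 0 <= relent u t.
Proof.
rewrite le_eqVlt => /predU1P[<-|u0] t0; first by rewrite /relent !mul0r; lra.
by have := xlnx_tangent_le t0 u0; rewrite /relent; lra.
Qed.

(** The log-sum inequality: [relent] is convex and 1-homogeneous, hence subadditive, and
    [relent e e = 0]. The side condition excludes [u > 0 = t], where the value ought to be infinite
    but [ln 0 = 0] makes it finite. *)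
Lemma relent_addr_le u t e : 0 < e -> 0 <= u -> 0 <= t -> (t = 0 -> u = 0) ->
  relent (u + e) (t + e) <= relent u t.
Proof.
move=> e0; rewrite le_eqVlt => /predU1P[<-|u0].
  rewrite le_eqVlt /relent !mul0r add0r => /predU1P[<- _|t0 _]; first by rewrite add0r; lra.
  have : e * ln e <= e * ln (t + e) by rewrite ler_pM2l// ler_ln ?posrE; lra.
  by lra.
rewrite le_eqVlt => /predU1P[<- /(_ erefl) u0'|t0 _]; first by rewrite u0' ltxx in u0.
pose r := (u + e) / (t + e).
have ue : 0 < u + e by lra.
have te : 0 < t + e by lra.
have r0 : 0 < r by rewrite divr_gt0.
have := @lnB_le R (r * t) u (mulr_gt0 r0 t0) u0; rewrite lnM ?posrE//.
move=> /(ler_wpM2l (ltW u0)).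
have -> : u * (r * t / u - 1) = r * t - u by field; rewrite !gt_eqF.
move=> h1.
have := ler_wpM2l (ltW e0) (ln_le_subr1 r0) => h2.
have lr : ln r = ln (u + e) - ln (t + e) by rewrite ln_div ?posrE.
have rt : r * (t + e) = u + e by rewrite divfK ?gt_eqF.
move: h1 h2 rt; rewrite /relent lr; clearbody r; lra.
Qed.

Lemma xlnx_norm_le u : 0 <= u -> `|u * ln u| <= 1 + u ^+ 2.
Proof.
rewrite le_eqVlt => /predU1P[<-|u0]; first by rewrite mul0r normr0 expr0n addr0.
have := xlnx_tangent_le (@ltr01 R) u0; rewrite ln1 mulr0 !add0r mulr1 => h.
have := ler_wpM2l (ltW u0) (ln_le_subr1 u0) => h'.
by rewrite ler_norml; apply/andP; split; nra.
Qed.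

(** Apply [ln t <= t - 1] at the inverse of the square root. This gives continuity of [u ln u] at
    0. *)
Lemma xlnx_norm_le_sqrt u : 0 <= u -> u <= 1 -> `|u * ln u| <= 2 * Num.sqrt u.
Proof.
rewrite le_eqVlt => /predU1P[<- _|u0 u1]; first by rewrite mul0r normr0 sqrtr0 mulr0.
set r := Num.sqrt u; have r0 : 0 < r by rewrite sqrtr_gt0.
have ur : u = r ^+ 2 by rewrite sqr_sqrtr// ltW.
have l0 : ln u <= 0 by exact: ln_le0.
rewrite ler0_norm; last by rewrite mulr_ge0_le0// ltW.
have := @ln_le_subr1 R r^-1; rewrite invr_gt0 lnV ?posrE// => /(_ r0) h.
have lu : ln u = 2 * ln r by rewrite {1}ur lnXn// mulr_natl.
have := ler_wpM2l (ltW u0) h; rewrite lu.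
have -> : u * (r^-1 - 1) = r - u by clear l0 lu; clearbody r; rewrite ur; field; rewrite gt_eqF.
lra.
Qed.

Lemma continuous_xlnx u : 0 <= u -> {for u, continuous (fun t => t * ln t)}.
Proof.
rewrite le_eqVlt => /predU1P[<-|u0]; last first.
  by apply: continuousM; [exact: cvg_id|exact: continuous_ln].
rewrite /prop_for /continuous_at mul0r.
apply/cvgr0Pnorm_le => e e0.
near=> t.
(* [ln] vanishes at nonpositive arguments, so only [t > 0] is at issue. *)
have [t0|t0] := leP t 0; first by rewrite (ln0 t0) mulr0 normr0 ltW.
have t1 : t <= 1.
  by apply/ltW; near: t; exact: lt_nbhsl.
apply: le_trans (xlnx_norm_le_sqrt (ltW t0) t1) _.
have te : t <= (e / 2) ^+ 2.
  by apply/ltW; near: t; apply: lt_nbhsl; rewrite exprn_gt0// divr_gt0.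
rewrite mulrC -ler_pdivlMr// -(ger0_norm (ltW (divr_gt0 e0 _)))//.
by rewrite -sqrtr_sqr ler_wsqrtr.
Unshelve. all: by end_near.
Qed.

End xlnx.

(** * Integration of bounded functions on a discrete probability space *)

Section discrete_space.
Context {R : realType} {T : pointedType} (P : probability (discrete T) R).
Implicit Types (A B F : set (discrete T)) (f g h : T -> R).

Definition bounded_fct f := exists M, forall x, `|f x| <= M.

Lemma measurable_discrete A : measurable A.
Proof. exact: sub_sigma_algebra. Qed.

Lemma measurable_fun_discrete (d : measure_display) (U : measurableType d) A
  (h : discrete T -> U) : measurable_fun A h.
Proof. by move=> _ B _; exact: measurable_discrete. Qed.

Lemma bounded_integrable A f : bounded_fct f ->
  P.-integrable A (EFin \o (f : discrete T -> R)).
Proof.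
move=> [M fM]; apply: measurable_bounded_integrable.
- exact: measurable_discrete.
- by rewrite (le_lt_trans (probability_le1 P (measurable_discrete A)))// ltry.
- exact: measurable_fun_discrete.
- exists M; split; first exact: num_real.
  by move=> y My x _; apply: le_trans (fM x) (ltW My).
Qed.

Lemma bounded_fct_cst (r : R) : bounded_fct (fun=> r).
Proof. by exists `|r|. Qed.

Lemma bounded_fctD f g : bounded_fct f -> bounded_fct g ->
  bounded_fct (fun x => f x + g x).
Proof.
move=> [M fM] [M' gM]; exists (M + M') => x.
by rewrite (le_trans (ler_normD _ _))// lerD.
Qed.

Lemma bounded_fctM f g : bounded_fct f -> bounded_fct g ->
  bounded_fct (fun x => f x * g x).
Proof.
by move=> [M fM] [M' gM]; exists (M * M') => x; rewrite normrM ler_pM.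
Qed.

Lemma bounded_fct_indic A : bounded_fct \1_A.
Proof.
exists 1 => x; rewrite indicE ger0_norm//.
by case: (x \in A); rewrite ?lexx ?ler01.
Qed.

Lemma bounded_fct_sum (J : Type) (s : seq J) (V : pred J) (h : J -> T -> R) :
  (forall j, bounded_fct (h j)) -> bounded_fct (fun x => \sum_(j <- s | V j) h j x).
Proof.
move=> hb; elim: s => [|j s IH].
  by under eq_fun do rewrite big_nil; exact: bounded_fct_cst.
under eq_fun do rewrite big_cons.
by case: (V j) => //; exact: bounded_fctD.
Qed.

Lemma Rintegral_sum_indic F (J : Type) (s : seq J) (V : pred J) (c : J -> R)
    (A : J -> set (discrete T)) :
  \int[P]_(x in F) (\sum_(j <- s | V j) c j * \1_(A j) x) =
  \sum_(j <- s | V j) c j * fine (P (A j `&` F)).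
Proof.
have ci j : bounded_fct (fun x : T => c j * \1_(A j) x).
  by apply: bounded_fctM; [exact: bounded_fct_cst|exact: bounded_fct_indic].
elim: s => [|j s IH].
  rewrite big_nil; under eq_Rintegral do rewrite big_nil.
  by rewrite Rintegral_cst ?mul0r//; exact: measurable_discrete.
rewrite big_cons; under eq_Rintegral do rewrite big_cons.
case: (V j) => //; rewrite RintegralD; last 3 first.
- exact: measurable_discrete.
- exact: bounded_integrable.
- by apply: bounded_integrable; exact: bounded_fct_sum.
rewrite IH RintegralZl; last 2 first.
- exact: measurable_discrete.
- by apply: bounded_integrable; exact: bounded_fct_indic.
by rewrite /Rintegral integral_indic//; exact: measurable_discrete.
Qed.

Lemma bounded_cvg_Rintegral (u : nat -> T -> R) f (M : R) :
  (forall n x, `|u n x| <= M) -> (forall x, u ^~ x @ \oo --> f x) ->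
  (\int[P]_x (u n x : R)) @[n --> \oo] --> \int[P]_x f x.
Proof.
move=> uM uf.
have cvg : (\int[P]_x (u n x)%:E)%E @[n --> \oo] --> (\int[P]_x (f x)%:E)%E.
  apply: (@dominated_cvg _ _ _ P setT _ (fun n x => (u n x)%:E) _ (fun=> M%:E)) => //.
  - by move=> n _ B _; exact: measurable_discrete.
  - by move=> x _; apply: cvg_EFin; [exact: nearW|exact: uf].
  - exact: (bounded_integrable _ (bounded_fct_cst M)).
  - by move=> n x _ /=; rewrite lee_fin.
apply: fine_cvg; rewrite fineK//.
apply: integrable_fin_num; first exact: measurable_discrete.
apply: bounded_integrable; exists M => x.
apply: (@cvgr_to_le _ _ _ _ _ _ _ (cvg_norm (uf x))).
exact: nearW.
Qed.

End discrete_space.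

(** * Finite sums of point masses against integrals *)

Section point_masses.
Context {R : realType} {T : pointedType} (P : probability (discrete T) R).
Implicit Types (F : set (discrete T)) (f g h : T -> R).

Lemma fine_probability_gt0 F : (0 < fine (P F)) = (fine (P F) != 0).
Proof. by rewrite lt_neqAle fine_ge0// andbT eq_sym. Qed.

Lemma fine_probability_le1 F : fine (P F) <= 1.
Proof.
have mF := measurable_discrete F.
by rewrite -lee_fin fineK ?fin_num_measure// probability_le1.
Qed.

Lemma le_bounded_Rintegral F f g : bounded_fct f -> bounded_fct g ->
  (forall x, f x <= g x) -> \int[P]_(x in F) f x <= \int[P]_(x in F) g x.
Proof.
move=> bf bg fg; apply: le_Rintegral => //.
- exact: measurable_discrete.
- exact: bounded_integrable.
- exact: bounded_integrable.
Qed.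

Lemma bounded_RintegralD F f g : bounded_fct f -> bounded_fct g ->
  \int[P]_(x in F) (f x + g x) = \int[P]_(x in F) f x + \int[P]_(x in F) g x.
Proof.
move=> bf bg; apply: RintegralD.
- exact: measurable_discrete.
- exact: bounded_integrable.
- exact: bounded_integrable.
Qed.

Lemma bounded_RintegralZl F f (r : R) : bounded_fct f ->
  \int[P]_(x in F) (r * f x) = r * \int[P]_(x in F) f x.
Proof.
move=> bf; apply: RintegralZl; first exact: measurable_discrete.
exact: bounded_integrable.
Qed.

Lemma discrete_Rintegral_cst F (r : R) : \int[P]_(x in F) r = r * fine (P F).
Proof. by rewrite Rintegral_cst//; exact: measurable_discrete. Qed.

Lemma bounded_fct_itv f (M : R) : (forall x, 0 <= f x) -> (forall x, f x <= M) ->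
  bounded_fct f.
Proof. by move=> f0 fM; exists M => x; rewrite ger0_norm. Qed.

Lemma bounded_fct_xlnx f (M : R) : (forall x, 0 <= f x) -> (forall x, f x <= M) ->
  bounded_fct (fun x => f x * ln (f x)).
Proof.
move=> f0 fM; exists (1 + M ^+ 2) => x; apply: le_trans (xlnx_norm_le (f0 x)) _.
by rewrite lerD2l ler_pXn2r// nnegrE// (le_trans (f0 x)).
Qed.

Section points.
Context {J : finType} (V : pred J) (y : J -> T).
Hypothesis y_inj : {in V &, injective y}.

(** Injectivity on [V] leaves at most one nonzero summand. *)
Lemma sum_point_indic h z : \sum_(j | V j) h (y j) * \1_[set y j] z =
  h z * \1_[set z | exists2 j, V j & y j = z] z.
Proof.
have [[j Vj <-]|nz] := pselect (exists2 j, V j & y j = z).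
  rewrite (bigD1 j)//= big1 ?addr0 => [|i /andP[Vi ij]].
    by rewrite !indicE !mem_set//=; exists j.
  rewrite indicE memNset ?mulr0//= => yij.
  by move: ij; rewrite (y_inj Vi Vj (esym yij)) eqxx.
rewrite [in RHS]indicE memNset// mulr0 big1// => j Vj.
by rewrite indicE memNset ?mulr0//= => zj; apply: nz; exists j.
Qed.

Lemma sum_point h : \sum_(j | V j) h (y j) * fine (P [set y j]) =
  \int[P]_z (h z * \1_[set z | exists2 j, V j & y j = z] z).
Proof.
under eq_Rintegral do rewrite -sum_point_indic.
rewrite Rintegral_sum_indic; apply: eq_bigr => j _.
by rewrite setIT.
Qed.

Lemma sum_point_le F h : (forall z, 0 <= h z) -> bounded_fct h ->
  \sum_(j | V j && (y j \in F)) h (y j) * fine (P [set y j]) <= \int[P]_(z in F) h z.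
Proof.
move=> h0 bh.
have -> : \sum_(j | V j && (y j \in F)) h (y j) * fine (P [set y j]) =
   \int[P]_(z in F) (\sum_(j | V j && (y j \in F)) h (y j) * \1_[set y j] z).
  rewrite Rintegral_sum_indic; apply: eq_bigr => j /andP[_ jF].
  by rewrite (_ : _ `&` F = [set y j])//; apply/setIidPl => _ /= ->; rewrite inE in jF.
apply: le_bounded_Rintegral => // [|z].
  apply: bounded_fct_sum => j.
  by apply: bounded_fctM; [exact: bounded_fct_cst|exact: bounded_fct_indic].
apply: (@le_trans _ _ (\sum_(j | V j) h (y j) * \1_[set y j] z)).
  rewrite [leRHS](bigID (fun j => y j \in F))/= lerDl sumr_ge0// => j _.
  by rewrite mulr_ge0.
by rewrite sum_point_indic ler_piMr// indicE.
Qed.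

End points.

Lemma point_mass_eq0 F f z : (forall x, 0 <= f x) -> bounded_fct f ->
  \int[P]_(x in F) f x = 0 -> F z -> f z * fine (P [set z]) = 0.
Proof.
move=> f0 bf If Fz.
have yinj : {in (fun _ : unit => true) &, injective (fun _ : unit => z)}.
  by move=> [] [].
have := sum_point_le yinj F f0 bf; rewrite If.
rewrite (big_pred1 tt)/=; last by case; rewrite mem_set.
by move=> h; apply/eqP; rewrite eq_le h mulr_ge0// fine_ge0.
Qed.

(** For [t > 0], the average of [f] over [F], the right-hand side is the integral over [F] of the
    nonnegative function [relent (f x) t], so it dominates any finite part. *)
Lemma cell_relent_le (J : finType) (V : pred J) (y : J -> T) F f (M t : R) :
  {in V &, injective y} -> (forall x, 0 <= f x) -> (forall x, f x <= M) ->
  0 <= t -> \int[P]_(x in F) f x = t * fine (P F) ->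
  \sum_(j | V j && (y j \in F)) relent (f (y j)) t * fine (P [set y j]) <=
  \int[P]_(x in F) (f x * ln (f x)) - fine (P F) * (t * ln t).
Proof.
move=> yinj f0 fM t0 tF.
have bf := bounded_fct_itv f0 fM.
have bx := bounded_fct_xlnx f0 fM.
have aff (r r' : R) : \int[P]_(x in F) (f x * ln (f x) + (r * f x + r')) =
    \int[P]_(x in F) (f x * ln (f x)) + (r * t + r') * fine (P F).
  have brf : bounded_fct (fun x => r * f x).
    by apply: bounded_fctM => //; exact: bounded_fct_cst.
  rewrite bounded_RintegralD// ?bounded_RintegralD//; last 2 first.
  - exact: bounded_fct_cst.
  - by apply: bounded_fctD => //; exact: bounded_fct_cst.
  by rewrite bounded_RintegralZl// discrete_Rintegral_cst tF; ring.
have brr (r r' : R) : bounded_fct (fun x => f x * ln (f x) + (r * f x + r')).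
  apply: bounded_fctD => //; apply: bounded_fctD; last exact: bounded_fct_cst.
  by apply: bounded_fctM => //; exact: bounded_fct_cst.
move: t0; rewrite le_eqVlt => /predU1P[t0|t0].
  have If : \int[P]_(x in F) f x = 0 by rewrite tF -t0 mul0r.
  rewrite big1 => [|j /andP[_ /set_mem jF]]; last first.
    have /eqP := point_mass_eq0 f0 bf If jF.
    rewrite mulf_eq0 => /orP[/eqP ->|/eqP ->]; last by rewrite mulr0.
    by rewrite /relent -t0 !mul0r !subr0 addr0 mul0r.
  (* [relent _ 0] is not pointwise nonnegative, as [ln 0 = 0]; integrate [relent (f x) e >= 0]
     instead and let [e] tend to 0. *)
  rewrite -t0 mul0r mulr0 subr0; apply/ler_addgt0Pr => e e0.
  have := @le_bounded_Rintegral F (fun=> 0)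
    (fun x => f x * ln (f x) + (- (ln e + 1) * f x + e)) (bounded_fct_cst _) (brr _ _).
  rewrite discrete_Rintegral_cst mul0r aff -t0 mulr0 add0r => h.
  apply: le_trans (h _) _ => [x|].
    have := relent_ge0 (f0 x) e0; rewrite /relent; lra.
  by rewrite lerD2l; apply: ler_piMr; [exact: ltW|exact: fine_probability_le1].
have := sum_point_le yinj F (h := fun x => f x * ln (f x) + (- (ln t + 1) * f x + t)).
have rE x : f x * ln (f x) + (- (ln t + 1) * f x + t) = relent (f x) t.
  by rewrite /relent; ring.
rewrite aff => /(_ _ (brr _ _)) h; under eq_bigr do rewrite -rE.
apply: le_trans (h _) _ => [x|]; first by rewrite rE relent_ge0.
by rewrite le_eqVlt; apply/orP; left; apply/eqP; ring.
Qed.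

End point_masses.

(** * Conditional means and entropies on fibres *)

Section conditional_entropy.
Context {R : realType} {N : nat} {Omega : 'I_N -> pointedType}.
Local Notation state := (forall i, Omega i).
Context (P : probability (discrete state) R) (f : state -> R) (M : R).
Hypotheses (f_ge0 : forall x, 0 <= f x) (f_le : forall x, f x <= M).
Implicit Types (k : 'I_N) (x z : state).

Lemma eq_fiber k x z : fiber k x z -> fiber k z = fiber k x.
Proof.
move=> xz; apply/seteqP; split=> y h j jk; first by rewrite h// xz.
by rewrite h// xz.
Qed.

Lemma eq_cmean k x z : fiber k x z -> cmean P k f z = cmean P k f x.
Proof. by move=> xz; rewrite /cmean (eq_fiber xz). Qed.

Lemma cmean_ge0 k x : 0 <= cmean P k f x.
Proof. by rewrite divr_ge0 ?Rintegral_ge0 ?fine_ge0. Qed.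

Lemma cmean_le k x : 0 <= M -> cmean P k f x <= M.
Proof.
move=> M0; rewrite /cmean; set F : set (discrete state) := fiber k x.
have [F0|F0] := eqVneq (fine (P F)) 0; first by rewrite F0 invr0 mulr0.
rewrite ler_pdivrMr ?fine_probability_gt0// -discrete_Rintegral_cst.
apply: le_bounded_Rintegral => //; last exact: bounded_fct_cst.
exact: bounded_fct_itv f_le.
Qed.

Lemma cmean_normr_le (g : state -> R) (B : R) k x : (forall x, `|g x| <= B) ->
  `|cmean P k g x| <= B.
Proof.
move=> gB; have B0 : 0 <= B by apply: le_trans (gB x).
rewrite /cmean; set F : set (discrete state) := fiber k x.
have [F0|F0] := eqVneq (fine (P F)) 0; first by rewrite F0 invr0 mulr0 normr0.
have PF : 0 < fine (P F) by rewrite fine_probability_gt0.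
have bg : bounded_fct g by exists B.
have bc r : bounded_fct (fun _ : state => r) by exact: bounded_fct_cst.
rewrite ler_norml ler_pdivlMr// ler_pdivrMr// -!discrete_Rintegral_cst.
by apply/andP; split; apply: le_bounded_Rintegral => // z;
  have := gB z; rewrite ler_norml => /andP[].
Qed.

Lemma bounded_cEnt k : bounded_fct (cEnt P k f).
Proof.
have [B gB] := bounded_fct_xlnx f_ge0 f_le.
have cM : forall x, cmean P k f x <= M.
  by move=> x; apply: cmean_le; apply: le_trans (f_le x).
have [B' cB] := bounded_fct_xlnx (cmean_ge0 k) cM.
exists (B + B') => x; rewrite /cEnt (le_trans (ler_normB _ _))// lerD//.
exact: cmean_normr_le.
Qed.

(** Supplies the side condition of [relent_addr_le]: a positive value of [f] at an atom would make
    the fibre average positive. *)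
Lemma cmean_eq0 k x : 0 < fine (P [set x]) -> cmean P k f x = 0 -> f x = 0.
Proof.
move=> Px /eqP; rewrite mulf_eq0 invr_eq0.
set F : set (discrete state) := fiber k x.
have PF : fine (P F) != 0.
  rewrite -fine_probability_gt0; apply: lt_le_trans Px _.
  have mF := measurable_discrete F; have mx := measurable_discrete ([set x] : set (discrete state)).
  rewrite fine_le ?fin_num_measure// le_measure ?inE//.
  by move=> _ ->.
rewrite (negbTE PF) orbF => /eqP /(point_mass_eq0 f_ge0 (bounded_fct_itv f_ge0 f_le)).
move=> /(_ x (fun _ _ => erefl)) /eqP; rewrite mulf_eq0 => /orP[/eqP//|].
by rewrite gt_eqF.
Qed.

(** The contribution of each listed point is spread evenly over its fibre. This keeps the integral
    and reduces the claim to a pointwise comparison with [cEnt], which is [cell_relent_le] on one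
    fibre. *)
Lemma mean_cEnt_ge (J : finType) (V : pred J) (y : J -> state) k :
  {in V &, injective y} ->
  \sum_(j | V j) fine (P [set y j]) * relent (f (y j)) (cmean P k f (y j)) <=
  mean P (cEnt P k f).
Proof.
move=> yinj.
pose c j := fine (P [set y j]) * relent (f (y j)) (cmean P k f (y j)) / fine (P (fiber k (y j))).
have -> : \sum_(j | V j) fine (P [set y j]) * relent (f (y j)) (cmean P k f (y j)) =
    \int[P]_z (\sum_(j | V j) c j * \1_(fiber k (y j) : set (discrete state)) z).
  rewrite Rintegral_sum_indic; apply: eq_bigr => j _; rewrite setIT /c.
  set F : set (discrete state) := fiber k (y j).
  have [F0|F0] := eqVneq (fine (P F)) 0; last by rewrite divfK.
  have mF := measurable_discrete F.
  have my := measurable_discrete ([set y j] : set (discrete state)).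
  suff -> : fine (P [set y j]) = 0 by rewrite !mul0r.
  apply/eqP; rewrite eq_le fine_ge0// andbT -F0 fine_le ?fin_num_measure//.
  by rewrite le_measure ?inE// => _ ->.
apply: le_bounded_Rintegral; [| exact: bounded_cEnt |] => [|z].
  apply: bounded_fct_sum => j.
  by apply: bounded_fctM; [exact: bounded_fct_cst|exact: bounded_fct_indic].
set F : set (discrete state) := fiber k z.
have fib j : y j \in F -> fiber k (y j) = F by move=> /set_mem; exact: eq_fiber.
have fibN j : (z \in (fiber k (y j) : set (discrete state))) = (y j \in F).
  by apply/idP/idP => /set_mem h; apply/mem_set => i ik; rewrite h.
have -> : \sum_(j | V j) c j * \1_(fiber k (y j) : set (discrete state)) z =
   (\sum_(j | V j && (y j \in F))
      relent (f (y j)) (cmean P k f z) * fine (P [set y j])) / fine (P F).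
  rewrite mulr_suml [LHS](bigID (fun j => y j \in F))/= [X in _ + X]big1 ?addr0.
    apply: eq_bigr => j /andP[_ jF]; rewrite indicE fibN jF mulr1 /c (fib _ jF).
    rewrite (eq_cmean (set_mem jF)); ring.
  by move=> j /andP[_ /negbTE jF]; rewrite indicE fibN jF mulr0.
(* On a null fibre both sides are 0, by division by 0. *)
have [F0|F0] := eqVneq (fine (P F)) 0.
  by rewrite /cEnt /cmean -/F F0 invr0 !mulr0 mul0r subr0.
have PF : 0 < fine (P F) by rewrite fine_probability_gt0.
rewrite ler_pdivrMr//.
have tF : \int[P]_(x in F) f x = cmean P k f z * fine (P F) by rewrite divfK.
apply: le_trans (cell_relent_le yinj f_ge0 f_le (cmean_ge0 k z) tF) _.
rewrite /cEnt mulrBl [X in _ <= X - _](_ : _ = \int[P]_(x in F) (f x * ln (f x))).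
  by rewrite [fine (P F) * _]mulrC.
by rewrite /cmean divfK.
Qed.

End conditional_entropy.

(** * Variational upper bound for the conditional entropy *)

Section relative_entropy_bound.
Context {R : realType} {I S : finType}.
Local Notation X := {ffun I -> S}.
Context (m : I -> S -> R) (G : X -> R).
Hypotheses (m_ge0 : forall i a, 0 <= m i a) (m_gt0 : forall i, 0 < \sum_a m i a)
  (G_gt0 : forall x, 0 < G x).

(** Since [t] does not depend on coordinate [k], [g] and [cond k g] agree in the linear terms, and
    the gap is the sum of [relent (cond k g) t] weighted by [mass]. *)
Lemma cond_ent_le_relent k (g t : X -> R) : (forall x, 0 < g x) ->
  (forall x, 0 < t x) -> (forall x a, t (upd x k a) = t x) ->
  cond_ent m G k g <= \sum_x mass m G x * relent (g x) (t x).
Proof.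
move=> g0 t0 tk; pose c := cond m G k g.
have c0 x : 0 < c x by exact: cond_gt0.
have e1 : \sum_x mass m G x * (c x * ln (t x)) = \sum_x mass m G x * (g x * ln (t x)).
  by apply: sum_cond => // x a; rewrite tk.
have e2 : \sum_x mass m G x * (c x * 1) = \sum_x mass m G x * (g x * 1).
  exact: sum_cond.
rewrite -subr_ge0.
suff -> : \sum_x mass m G x * relent (g x) (t x) - cond_ent m G k g =
    \sum_x mass m G x * relent (c x) (t x).
  apply: sumr_ge0 => x _; rewrite mulr_ge0 ?mass_ge0// relent_ge0//; exact: ltW.
transitivity (\sum_x mass m G x * relent (c x) (t x) +
  (\sum_x mass m G x * (c x * ln (t x)) - \sum_x mass m G x * (g x * ln (t x))) +
  (\sum_x mass m G x * (c x * 1) - \sum_x mass m G x * (g x * 1))).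
  rewrite -!sumrB -!big_split; apply: eq_bigr => x _ /=.
  by rewrite /relent -/c; ring.
by rewrite e1 e2 !subrr !addr0.
Qed.

End relative_entropy_bound.

(** * Truncation of Gibbs measures *)

(** Numbers that code no point are decoded to [point], so in general only one composition is the
    identity. *)
Lemma countable_coding (T : pointedType) : countable [set: T] ->
  exists ed : (T -> nat) * (nat -> T), cancel ed.1 ed.2.
Proof.
move=> /countable_injP[e einj].
exists (e, fun n => xget point [set a | e a = n]) => a /=.
have ea : exists b, [set b | e b = e a] b by exists a.
by apply: einj; rewrite ?inE//; exact: (xgetPex point ea).
Qed.

(** * Mixed differences of the interaction *)

Section interaction_bound.
Context {R : realType} {N : nat} {Omega : 'I_N -> pointedType}.
Local Notation state := (forall i, Omega i).
Context (beta : R) (J : 'I_N -> 'I_N -> R) (w : forall i j : 'I_N, Omega i -> Omega j -> R).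
Hypotheses (beta_gt0 : 0 < beta) (J_sym : forall i j, J i j = J j i)
  (w_bounded : forall i j, has_ubound (abs_values (@w i j)))
  (w_sym : forall i j, supnorm (@w i j) = supnorm (@w j i)).
Implicit Types i k : 'I_N.

Lemma le_supnorm i k a b : `|@w i k a b| <= supnorm (@w i k).
Proof. by apply: ub_le_sup => //; exists a, b. Qed.

Lemma epsilon_ge0 i k : 0 <= epsilon beta J w i k.
Proof.
apply: mulr_ge0; first by rewrite !mulr_ge0// ltW.
exact: le_trans (@le_supnorm i k point point).
Qed.

Lemma epsilon_sym i k : epsilon beta J w i k = epsilon beta J w k i.
Proof. by rewrite /epsilon J_sym w_sym. Qed.

(** In the mixed second difference only the pairs [(i, k)] and [(k, i)] survive. Each contributes at
    most [b], one bound for each of four terms, and the factor 1/2 in the interaction compensates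
    for the two pairs. *)
Lemma interaction_mixed_le i k (xac xbd xad xbc : state) : i != k ->
  (forall j, j != i -> xac j = xbc j) -> (forall j, j != i -> xad j = xbd j) ->
  (forall j, j != k -> xac j = xad j) -> (forall j, j != k -> xbc j = xbd j) ->
  beta * (interaction J w xac + interaction J w xbd) <=
  epsilon beta J w i k + beta * (interaction J w xad + interaction J w xbc).
Proof.
move=> ik hi hi' hk hk'.
pose T j l (z : state) := J j l * w (z j) (z l).
pose b := 4 * (`|J k i| * supnorm (@w i k)).
have Tb j l z : `|T j l z| <= `|J j l| * supnorm (@w j l).
  by rewrite normrM ler_wpM2l// le_supnorm.
have main j l : T j l xac + T j l xbd - (T j l xad + T j l xbc) <=
    b * ((j == i) && (l == k))%:R + b * ((j == k) && (l == i))%:R.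
  have four : T j l xac + T j l xbd - (T j l xad + T j l xbc) <=
      4 * (`|J j l| * supnorm (@w j l)).
    have := Tb j l xac; have := Tb j l xbd; have := Tb j l xad; have := Tb j l xbc.
    by rewrite !ler_norml => /andP[? ?] /andP[? ?] /andP[? ?] /andP[? ?]; lra.
  have b0 : 0 <= b by rewrite !mulr_ge0// (le_trans (normr_ge0 _) (@le_supnorm i k point point)).
  have [/andP[/eqP ji /eqP lk]|njl] := boolP ((j == i) && (l == k)).
    rewrite mulr1; apply: le_trans four _; rewrite ji lk J_sym lerDl mulr_ge0//.
  have [/andP[/eqP jk /eqP li]|njl'] := boolP ((j == k) && (l == i)).
    by rewrite mulr1 mulr0 add0r; apply: le_trans four _; rewrite jk li w_sym.
  rewrite !mulr0 addr0.
  have [jl|jl] := boolP ((j != i) && (l != i)).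
    by case/andP: jl => ji li; rewrite /T !hi// !hi'//; lra.
  have [jl'|jl'] := boolP ((j != k) && (l != k)).
    by case/andP: jl' => jk lk; rewrite /T !hk// !hk'//; lra.
  move: jl jl' njl njl'; rewrite !negb_and !negbK => /orP[/eqP->|/eqP->].
    by rewrite !eqxx (negbTE ik)/= => ->.
  by rewrite !eqxx (negbTE ik)/= orbF => ->; rewrite orbF.
have WE z : interaction J w z = 2^-1 * \sum_(j < N) \sum_(l < N) T j l z by [].
have S1 i' k' : \sum_(j < N) \sum_(l < N) b * ((j == i') && (l == k'))%:R = b.
  rewrite (bigD1 i')//= (bigD1 k')//= !eqxx mulr1 big1 ?addr0 => [|l /negbTE ->].
    rewrite big1 ?addr0// => j /negbTE ->.
    by rewrite big1// => l _; rewrite mulr0.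
  by rewrite mulr0.
have : \sum_(j < N) \sum_(l < N) (T j l xac + T j l xbd - (T j l xad + T j l xbc)) <=
    \sum_(j < N) \sum_(l < N) (b * ((j == i) && (l == k))%:R + b * ((j == k) && (l == i))%:R).
  by apply: ler_sum => j _; apply: ler_sum => l _; exact: main.
under eq_bigr do rewrite sumrB !big_split/=.
rewrite sumrB !big_split/=.
under [X in _ <= X -> _]eq_bigr do rewrite big_split/=.
rewrite big_split/= !S1 => h.
have eE : epsilon beta J w i k = beta * b by rewrite /epsilon /b; ring.
rewrite eE -[leRHS]mulrDr ler_pM2l// !WE; lra.
Qed.

End interaction_bound.

(** * Finite boxes and the restricted Gibbs weight *)

Section truncation.
Context {R : realType} {N : nat} {Omega : 'I_N -> pointedType}.
Local Notation state := (forall i, Omega i).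
Context (mu0 : forall i, probability (discrete (Omega i)) R) (beta : R)
  (J : 'I_N -> 'I_N -> R) (w : forall i j : 'I_N, Omega i -> Omega j -> R)
  (mu : probability (discrete state) R).
Hypothesis mu_gibbs : is_gibbs mu0 beta J w mu.
Context (e : forall i, Omega i -> nat) (d : forall i, nat -> Omega i).
Hypothesis edK : forall i, cancel (@e i) (@d i).
Implicit Type n : nat.
Local Notation X n := {ffun 'I_N -> 'I_n}.
Local Notation Z := (partition_function mu0 beta J w).

Definition decode n (x : X n) : state := fun i => d i (x i).

Definition is_code n (x : X n) : bool := [forall i, e (d i (x i)) == x i].

(* A number s < n that codes no point of Omega i gets weight 0; is_code selects
   the states avoiding such numbers. *)
Definition trunc_weight n i (s : 'I_n) : R :=
  if e (d i s) == s then fine (mu0 i [set d i s]) else 0.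

Definition trunc_density n (x : X n) : R := expR (beta * interaction J w (decode x)).

Definition box n : set (discrete state) :=
  [set z | exists2 x : X n, is_code x & decode x = z].

Lemma decode_inj n : {in @is_code n &, injective (@decode n)}.
Proof.
move=> x y /forallP cx /forallP cy xy; apply/ffunP => i; apply/val_inj => /=.
rewrite -(eqP (cx i)) -(eqP (cy i)).
by have := congr1 (fun z : state => e (z i)) xy; rewrite /decode.
Qed.

Lemma box_near (z : state) : \forall n \near \oo, box n z.
Proof.
(* The sum of the codes dominates each single code. *)
exists (\sum_i e (z i)).+1 => // n /= zn.
have lt i : (e (z i) < n)%N.
  by apply: leq_trans zn; rewrite ltnS (bigD1 i)//= leq_addr.
exists [ffun i => Ordinal (lt i)].
  by apply/forallP => i; rewrite ffunE/= edK.
by apply: functional_extensionality_dep => i; rewrite /decode ffunE/= edK.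
Qed.

Lemma cvg_box_indic (z : state) : (\1_(box n) z : R) @[n --> \oo] --> (1 : R).
Proof.
apply: cvg_near_cst; near=> n; rewrite indicE mem_set//.
by near: n; exact: box_near.
Unshelve. all: by end_near.
Qed.

Lemma cvg_box : \int[mu]_z (\1_(box n) z : R) @[n --> \oo] --> (1 : R).
Proof.
have -> : 1 = \int[mu]_z (1 : R) :> R.
  by rewrite discrete_Rintegral_cst probability_setT mul1r.
apply: (bounded_cvg_Rintegral (M := 1)) => [n z|z]; last exact: cvg_box_indic.
by rewrite indicE ger0_norm//; case: (_ \in _); rewrite ?lexx ?ler01.
Qed.

(** Boxes are finite, so they would all be null if no point had mass, whereas their measure tends to
    1. *)
Lemma exists_atom : exists z : state, 0 < fine (mu [set z]).
Proof.
apply: contrapT => /forallNP no.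
have no0 z : fine (mu [set z]) = 0.
  by apply/eqP; rewrite -[_ == _]negbK -fine_probability_gt0; apply/negP/no.
have := cvg_box; under eq_cvg => n.
  have -> : \int[mu]_z (\1_(box n) z : R) = 0.
    transitivity (\int[mu]_z (1 * \1_(box n) z : R)).
      by apply: eq_Rintegral => z _; rewrite mul1r.
    rewrite -(sum_point mu (@decode_inj n) (fun=> 1)).
    by rewrite big1// => x _; rewrite no0 mulr0.
  over.
move=> h; suff : 1 <= 0 :> R by rewrite ler10.
by apply: (cvgr_to_le h); exact: nearW.
Qed.

(** If [Z] were 0, possibly as [fine] of an infinite sum, division by 0 would give every point mass
    0. *)
Lemma partition_function_gt0 : 0 < Z.
Proof.
have [z z0] := exists_atom.
have Z0 : 0 <= Z.
  apply: fine_ge0; apply: esum_ge0 => x _; rewrite lee_fin mulr_ge0 ?expR_ge0//.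
  by apply: prodr_ge0 => i _; exact: fine_ge0.
rewrite lt_neqAle Z0 andbT eq_sym; apply/eqP => Z_eq0.
by move: z0; rewrite mu_gibbs Z_eq0 invr0 mulr0 ltxx.
Qed.

Lemma gibbs_weightE z : gibbs_weight mu0 beta J w z = Z * fine (mu [set z]).
Proof. by rewrite mu_gibbs /= mulrC divfK ?gt_eqF ?partition_function_gt0. Qed.

Lemma trunc_weight_ge0 n i (s : 'I_n) : 0 <= trunc_weight i s.
Proof. by rewrite /trunc_weight; case: ifP => // _; exact: fine_ge0. Qed.

Lemma trunc_density_gt0 n (x : X n) : 0 < trunc_density x.
Proof. exact: expR_gt0. Qed.

(** The truncated weight is [Z] times the restriction of [mu] to the box, which is what makes the
    finite theorem applicable. *)
Lemma trunc_mass n (x : X n) :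
  mass (@trunc_weight n) (@trunc_density n) x =
  if is_code x then Z * fine (mu [set decode x]) else 0.
Proof.
rewrite -gibbs_weightE /mass; have [/forallP cx|] := ifPn.
  congr (_ * _); apply: eq_bigr => i _.
  by rewrite /trunc_weight (cx i).
rewrite negb_forall => /existsP[i /negbTE ci].
by rewrite (bigD1 i)//= /trunc_weight ci !mul0r.
Qed.

Lemma sum_trunc_mass n (h : state -> R) :
  \sum_x mass (@trunc_weight n) (@trunc_density n) x * h (decode x) =
  Z * \int[mu]_z (h z * \1_(box n) z).
Proof.
rewrite -(sum_point mu (@decode_inj n)) mulr_sumr [RHS]big_mkcond.
by apply: eq_bigr => x _; rewrite trunc_mass; case: ifP => _; [ring|rewrite mul0r].
Qed.

(** Once the box contains an atom of [mu], each coordinate has positive weight, a factor of the mass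
    of that atom. *)
Lemma trunc_weight_sum_gt0 : \forall n \near \oo,
  forall i, 0 < \sum_(s < n) trunc_weight i s.
Proof.
have [z z0] := exists_atom.
near=> n => i.
have [x cx xz] : box n z by near: n; exact: box_near.
have : 0 < trunc_weight i (x i).
  have : 0 < gibbs_weight mu0 beta J w z by rewrite gibbs_weightE mulr_gt0// partition_function_gt0.
  rewrite /trunc_weight (forallP cx i) /gibbs_weight pmulr_lgt0 ?expR_gt0// => p0.
  rewrite lt_neqAle fine_ge0// andbT eq_sym; apply/eqP => xi0.
  move: p0; rewrite /product_mass (bigD1 i)//= -xz /decode xi0 mul0r ltxx//.
move=> xi; rewrite (bigD1 (x i))//= ltr_pwDl// sumr_ge0// => s _.
exact: trunc_weight_ge0.
Unshelve. all: by end_near.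
Qed.

End truncation.

(** * The entropy inequality on a box *)

Section truncated_inequality.
Context {R : realType} {N : nat} {Omega : 'I_N -> pointedType}.
Local Notation state := (forall i, Omega i).
Context (mu0 : forall i, probability (discrete (Omega i)) R) (beta : R)
  (J : 'I_N -> 'I_N -> R) (w : forall i j : 'I_N, Omega i -> Omega j -> R)
  (mu : probability (discrete state) R) (f : state -> R) (M : R).
Hypotheses (beta_gt0 : 0 < beta) (J_sym : forall i j, J i j = J j i)
  (w_bounded : forall i j, has_ubound (abs_values (@w i j)))
  (w_sym : forall i j, supnorm (@w i j) = supnorm (@w j i))
  (mu_gibbs : is_gibbs mu0 beta J w mu)
  (q_lt : influence beta J w < 2 / 3)
  (f_ge0 : forall x, 0 <= f x) (f_le : forall x, f x <= M).
Context (e : forall i, Omega i -> nat) (d : forall i, nat -> Omega i).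
Hypothesis edK : forall i, cancel (@e i) (@d i).
Local Notation Z := (partition_function mu0 beta J w).
Local Notation mass n := (mass (@trunc_weight _ _ _ mu0 e d n) (@trunc_density _ _ _ beta J w d n)).
Local Notation box n := (@box _ _ e d n).
Local Notation decode := (decode d).

Let cmean_decode_eq0 n (x : {ffun 'I_N -> 'I_n}) k : 0 < mass n x ->
  cmean mu k f (decode x) = 0 -> f (decode x) = 0.
Proof.
rewrite (trunc_mass mu_gibbs edK); case: ifP => [_|]; last by rewrite ltxx.
rewrite pmulr_rgt0 ?(partition_function_gt0 mu_gibbs edK)//.
exact: cmean_eq0.
Qed.

(** The finite theorem is applied to [f + a] on the box, and the factor [Z] cancels. Its right-hand
    side is brought back to [mu] in three steps: the competitor [cmean + a] in the variational
    bound, removal of [a], and passage from the box to the whole space. *)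
Lemma truncated_inequality n (a : R) : 0 < a ->
  (forall i, 0 < \sum_(s < n) trunc_weight mu0 e d i s) ->
  (1 - 3 / 2 * influence beta J w) *
  (\int[mu]_z ((f z + a) * ln (f z + a) * \1_(box n) z) -
   \int[mu]_z ((f z + a) * \1_(box n) z) *
     ln (\int[mu]_z ((f z + a) * \1_(box n) z) / \int[mu]_z (\1_(box n) z))) <=
  \sum_(k < N) mean mu (cEnt mu k f).
Proof.
move=> a0 m0.
have Z0 := partition_function_gt0 mu_gibbs edK.
have w0 i s := @trunc_weight_ge0 _ _ _ mu0 e d n i s.
have G0 x := @trunc_density_gt0 _ _ _ beta J w d n x.
pose E i k := expR (epsilon beta J w i k).
have E1 i k : 1 <= E i k.
  by rewrite -[leLHS]expR0 ler_expR epsilon_ge0.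
have E_sym i k : E i k = E k i by rewrite /E epsilon_sym.
have G_ratio i k (x : {ffun 'I_N -> 'I_n}) (b b' c c' : 'I_n) : i != k ->
    trunc_density beta J w d (upd (upd x i b) k c) *
    trunc_density beta J w d (upd (upd x i b') k c') <=
    E i k * (trunc_density beta J w d (upd (upd x i b) k c') *
             trunc_density beta J w d (upd (upd x i b') k c)).
  move=> ik; rewrite /trunc_density -!expRD ler_expR -!(mulrDr beta).
  by apply: (interaction_mixed_le beta_gt0 J_sym w_bounded w_sym ik) => j /negbTE jik;
    rewrite /decode !ffunE jik.
have qE i : \sum_(k < N | k != i) E i k * (E i k ^+ 2 - 1) <= influence beta J w.
  apply: le_trans (le_bigmax _ _ i) => /=; rewrite le_eqVlt; apply/orP; left; apply/eqP.
  apply: eq_bigr => k _; congr (_ * (_ - _)).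
  by rewrite /E -expRM_natl mulr_natl.
pose g (x : {ffun 'I_N -> 'I_n}) := f (decode x) + a.
have g0 x : 0 < g x by rewrite ltr_wpDl.
have := fent_le_sum_cond_ent w0 m0 G0 E1 E_sym G_ratio qE q_lt g0.
have sums := sum_trunc_mass mu_gibbs edK n.
have -> : fent (@trunc_weight _ _ _ mu0 e d n) (@trunc_density _ _ _ beta J w d n) g =
    Z * (\int[mu]_z ((f z + a) * ln (f z + a) * \1_(box n) z) -
   \int[mu]_z ((f z + a) * \1_(box n) z) *
     ln (\int[mu]_z ((f z + a) * \1_(box n) z) / \int[mu]_z (\1_(box n) z))).
  rewrite /fent (sums (fun z => (f z + a) * ln (f z + a))) (sums (fun z => f z + a)).
  have -> : \sum_x mass n x = Z * \int[mu]_z (\1_(box n) z).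
    rewrite -[LHS]mulr1 mulr_suml (sums (fun=> 1)); congr (_ * _).
    by apply: eq_Rintegral => z _; rewrite mul1r.
  rewrite mulrBr -mulrA; congr (_ - _ * (_ * ln _)).
  by rewrite invfM mulrACA divff ?mul1r// gt_eqF.
rewrite mulrCA => h; rewrite -(ler_pM2l Z0); apply: le_trans h _.
rewrite mulr_sumr; apply: ler_sum => k _.
apply: le_trans (@cond_ent_le_relent _ _ _ _ _ w0 m0 G0 k g
  (fun x => cmean mu k f (decode x) + a) g0 _ _) _ => [x|x s|].
- by rewrite ltr_wpDl// cmean_ge0.
- congr (_ + _); apply: eq_cmean => j /negbTE jk.
  by rewrite /decode ffunE jk.
apply: (@le_trans _ _ (\sum_x mass n x * relent (f (decode x)) (cmean mu k f (decode x)))).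
  apply: ler_sum => x _.
  have [<-|mx] := eqVneq 0 (mass n x); first by rewrite !mul0r.
  have m_ge0 : 0 <= mass n x by apply: mass_ge0.
  have m_gt0 : 0 < mass n x by rewrite lt_neqAle mx.
  rewrite ler_pM2l//; apply: relent_addr_le => //; first exact: cmean_ge0.
  exact: cmean_decode_eq0.
apply: le_trans (_ : Z * (\sum_(x | is_code e d x) fine (mu [set decode x]) *
   relent (f (decode x)) (cmean mu k f (decode x))) <= _).
  rewrite mulr_sumr [leRHS]big_mkcond; apply: ler_sum => x _.
  by rewrite (trunc_mass mu_gibbs edK); case: ifP => _; rewrite ?mul0r// mulrA.
by rewrite ler_pM2l//; apply: mean_cEnt_ge f_ge0 f_le _ _ _ _ (@decode_inj _ _ e d n).
Qed.

End truncated_inequality.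

(** * Exhaustion by boxes and passage to the limit *)

Theorem corollary2p3 (R : realType) (N : nat) (Omega : 'I_N -> pointedType)
    (Omega_countable : forall i, countable [set: Omega i])
    (mu0 : forall i, probability (discrete (Omega i)) R)
    (beta : R) (beta_gt0 : 0 < beta)
    (J : 'I_N -> 'I_N -> R)
    (J_diag : forall i, J i i = 0) (J_sym : forall i j, J i j = J j i)
    (w : forall i j : 'I_N, Omega i -> Omega j -> R)
    (w_bounded : forall i j, has_ubound (abs_values (w i j)))
    (* w_{i,j} and w_{j,i} describe the same pair (i,j): in particular
       their norms agree. Without this the claim fails. *)
    (w_sym : forall i j, supnorm (w i j) = supnorm (w j i))
    (mu : probability (discrete (forall i, Omega i)) R)
    (mu_gibbs : is_gibbs mu0 beta J w mu)
    (q_lt : influence beta J w < 2 / 3)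
    (f : (forall i, Omega i) -> R)
    (f_meas : measurable_fun [set: discrete (forall i, Omega i)] f)
    (f_ge0 : forall x, 0 <= f x)
    (f_bounded : exists M : R, forall x, f x <= M) :
  Ent mu f <=
    (1 - 3 / 2 * influence beta J w)^-1 *
    \sum_(k < N) mean mu (cEnt mu k f).
Proof.
have [M f_le] := f_bounded.
pose ed i := sval (cid (countable_coding (Omega_countable i))).
pose e i := (ed i).1; pose d i := (ed i).2.
have edK i : cancel (e i) (d i) := svalP (cid (countable_coding (Omega_countable i))).
rewrite ler_pdivlMl; last by lra.
(* One index drives both limits: the shift tends to 0 while the boxes exhaust the space. *)
pose a n : R := n.+1%:R^-1.
have a_gt0 n : 0 < a n by rewrite invr_gt0.
have a_le1 n : a n <= 1 by rewrite invf_le1// ler1n.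
have a_cvg : a @ \oo --> (0 : R) by exact: cvg_harmonic.
pose ind n z : R := \1_(box e d n) z.
have ind_le n z : `|ind n z| <= 1.
  by rewrite /ind indicE ger0_norm//; case: (_ \in _); rewrite ?lexx ?ler01.
have ind_cvg z : ind ^~ z @ \oo --> (1 : R) by exact: cvg_box_indic.
have fa_cvg z : (f z + a n) @[n --> \oo] --> f z.
  by rewrite -[X in _ --> X]addr0; apply: cvgD => //; exact: cvg_cst.
have fa_ge0 n z : 0 <= f z + a n by rewrite addr_ge0// ltW.
have fa_le n z : f z + a n <= M + 1 by rewrite lerD.
pose A n := \int[mu]_z ((f z + a n) * ind n z).
pose B n := \int[mu]_z (ind n z).
pose U n := \int[mu]_z ((f z + a n) * ln (f z + a n) * ind n z).
have B_cvg : B @ \oo --> (1 : R) by exact: cvg_box.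
have A_cvg : A @ \oo --> \int[mu]_z f z.
  apply: (bounded_cvg_Rintegral (M := M + 1)) => [n z|z].
    by rewrite normrM -[leRHS]mulr1 ler_pM// ger0_norm.
  by rewrite -[X in _ --> X]mulr1; exact: cvgM.
have U_cvg : U @ \oo --> \int[mu]_z (f z * ln (f z)).
  apply: (bounded_cvg_Rintegral (M := 1 + (M + 1) ^+ 2)) => [n z|z].
    rewrite normrM -[leRHS]mulr1 ler_pM//.
    apply: le_trans (xlnx_norm_le (fa_ge0 n z)) _.
    by rewrite lerD2l ler_pXn2r// nnegrE// (le_trans (fa_ge0 n z)).
  rewrite -[X in _ --> X]mulr1; apply: cvgM => //.
  exact: (continuous_cvg _ (continuous_xlnx (f_ge0 z)) (fa_cvg z)).
have A_ge0 : 0 <= \int[mu]_z f z by exact: Rintegral_ge0.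
(* Splitting the logarithm of the quotient keeps the limit valid when the mean of [f] is 0: [x ln x]
   is continuous there, and [ln (B n)] tends to 0. *)
have AB_cvg : (A n * ln (A n) - A n * ln (B n)) @[n --> \oo] -->
    (\int[mu]_z f z) * ln (\int[mu]_z f z).
  rewrite -[X in _ --> X]subr0; apply: cvgB.
    exact: (continuous_cvg _ (continuous_xlnx A_ge0) A_cvg).
  rewrite -[X in _ --> X](mulr0 (\int[mu]_z f z)) -[X in _ * X]ln1; apply: cvgM => //.
  by apply: continuous_cvg => //; apply: continuous_ln.
pose c := 1 - 3 / 2 * influence beta J w.
have lim : c * (U n - (A n * ln (A n) - A n * ln (B n))) @[n --> \oo] --> c * Ent mu f.
  by apply: cvgM; [exact: cvg_cst|exact: cvgB].
apply: (cvgr_to_le lim); near=> n.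
have m0 : forall i, 0 < \sum_(s < n) trunc_weight mu0 e d i s.
  by near: n; exact: (trunc_weight_sum_gt0 mu_gibbs edK).
have Bn : 0 < B n by near: n; exact: (cvgr_gt _ B_cvg).
(* The shift makes the integral positive over a box of positive measure, so the logarithm of the
   quotient can be split. *)
have An : 0 < A n.
  apply: lt_le_trans (_ : a n * B n <= _); first by rewrite mulr_gt0.
  have bi : bounded_fct (ind n) by exact: bounded_fct_indic.
  rewrite -bounded_RintegralZl//; apply: le_bounded_Rintegral => [||z].
  - by apply: bounded_fctM => //; exact: bounded_fct_cst.
  - by apply: bounded_fctM => //; exact: bounded_fct_itv (fa_ge0 n) (fa_le n).
  by rewrite ler_wpM2r ?lerDr ?f_ge0// /ind indicE ler0n.
rewrite -mulrBr -ln_div ?posrE//.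
exact: (@truncated_inequality _ _ _ _ _ _ _ _ _ M).
Unshelve. all: by end_near.
Qed.
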